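(* Let $\mathbb G$, $d$, $\Omega_*$ and $\phi$ be as in the context. Let $g_0=(x_0,t_0)\in\mathbb M$ and let $\theta_0\in\Omega_*$ be the (unique) nondegenerate critical point of $\phi(g_0;\cdot)$ in $\Omega_*$. Then $$d(g_0)^2=\phi(g_0;\theta_0)=\sup_{\tau\in\Omega_*}\phi(g_0;\tau).$$
   Context: Let $q,m\ge1$, $U^{(1)},\dots,U^{(m)}$ linearly independent real skew-symmetric $q\times q$ matrices, $\mathbb G=\mathbb R^q\times\mathbb R^m$ with law $(x,t)\cdot(x',t')=(x+x',t+t'+\frac12\langle\mathbb Ux,x'\rangle)$, $\langle\mathbb Ux,x'\rangle=(\langle U^{(j)}x,x'\rangle)_{j=1}^m$, identity $o=(0,0)$. $d(g)=d(o,g)$ where $d$ is the Carnot–Carathéodory distance: $d(o,g)$ is the infimum of $\int_0^1|x'(s)|ds$ over absolutely continuous curves $(x(s),t(s))$ from $o$ to $g$ with $t'=\frac12\langle\mathbb Ux,x'\rangle$. $U(\tau)=i\sum_j\tau_jU^{(j)}$, $\Omega_*=\{\tau\in\mathbb R^m:\|U(\tau)\|<\pi\}$, $\phi((x,t);\tau)=\langle U(\tau)\cot U(\tau)x,x\rangle+4t\cdot\tau$ for $\tau\in\Omega_*$. $\mathbb M$ is the set of $g\in\mathbb G$ for which there exists $\theta\in\Omega_*$ with $\nabla_\tau\phi(g;\theta)=0$ and $\det\mathrm{Hess}_\tau\phi(g;\theta)\ne0$ (a nondegenerate critical point). *)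

(* Defs.v *)
(* mathcomp-analysis over an abstract R : realType,
   complex numbers R[i] from mathcomp-real-closed. *)
From HB Require Import structures.
From mathcomp Require Import all_boot all_order all_algebra.
From mathcomp Require Import all_classical all_reals all_analysis.
From mathcomp Require Import complex.
Set Implicit Arguments. Unset Strict Implicit. Unset Printing Implicit Defensive.
Import Order.TTheory GRing.Theory Num.Theory.
Import numFieldNormedType.Exports.
Local Open Scope classical_set_scope.
Local Open Scope ring_scope.

Section Defs.
Variable R : realType.
Variables q m : nat.
(* the family U^(1),...,U^(m), indexed by 'I_m *)
Variable U : 'I_m -> 'M[R]_q.

(* ---------- hypotheses on the family U ---------- *)
Definition skew_family : Prop := forall j, (U j)^T = - U j.
Definition lin_indep : Prop :=
  forall c : 'I_m -> R, \sum_(j < m) c j *: U j = 0 -> forall j, c j = 0.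

(* ---------- the group G = R^q x R^m ---------- *)
Definition grp := ('rV[R]_q * 'rV[R]_m)%type.

(* <U x, y> = (<U^(j) x, y>)_j , with <A x, y> = sum_a (A x)_a y_a *)
Definition brk (x y : 'rV[R]_q) : 'rV[R]_m :=
  \row_(j < m) \sum_(a < q) \sum_(b < q) U j a b * x 0 b * y 0 a.

Definition grp_mul (g h : grp) : grp :=
  (g.1 + h.1, g.2 + h.2 + 2^-1 *: brk g.1 h.1).

(* Euclidean norm on R^q *)
Definition enorm (v : 'rV[R]_q) : R := Num.sqrt (\sum_(a < q) v 0 a ^+ 2).

(* absolute continuity of f : R -> V on [a,b] *)
Definition abs_cont (V : normedModType R) (f : R -> V) (a b : R) : Prop :=
  forall eps : R, 0 < eps -> exists2 delta : R, 0 < delta &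
    forall (n : nat) (l r : 'I_n -> R),
      (forall k, a <= l k /\ l k <= r k /\ r k <= b) ->
      (forall k k', k != k' -> r k <= l k' \/ r k' <= l k) ->
      \sum_(k < n) (r k - l k) < delta ->
      \sum_(k < n) `| f (r k) - f (l k) | < eps.

(* horizontal absolutely continuous curve s |-> (x(s), t(s)) from o to g *)
Definition horizontal_curve (x : R -> 'rV[R]_q) (t : R -> 'rV[R]_m) (g : grp) : Prop :=
  [/\ abs_cont x 0 1 /\ abs_cont t 0 1,
      x 0 = 0 /\ t 0 = 0, x 1 = g.1 /\ t 1 = g.2 &
      {ae (@lebesgue_measure R), forall s, s \in `[0, 1] ->
          [/\ derivable x s 1, derivable t s 1 &
              derive t s 1 = 2^-1 *: brk (x s) (derive x s 1)]}].

(* length int_0^1 |x'(s)| ds *)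
Definition curve_length (x : R -> 'rV[R]_q) : \bar R :=
  (\int[@lebesgue_measure R]_(s in `[0%R, 1%R]) (enorm (derive x s 1))%:E)%E.

(* Carnot-Caratheodory distance d(g) = d(o, g) *)
Definition dcc (g : grp) : \bar R :=
  ereal_inf [set L | exists x t, horizontal_curve x t g /\ L = curve_length x].

(* ---------- complex matrices and functional calculus ---------- *)
Local Open Scope complex_scope.

Definition toC (r : R) : R[i] := r%:C.

(* U(tau) = i sum_j tau_j U^(j)  (a Hermitian q x q complex matrix) *)
Definition Umat (tau : 'rV[R]_m) : 'M[R[i]]_q :=
  'i *: \sum_(j < m) toC (tau 0 j) *: map_mx toC (U j).

Definition cnorm2 (z : R[i]) : R := complex.Re z ^+ 2 + complex.Im z ^+ 2.
Definition cvnorm (v : 'cV[R[i]]_q) : R := Num.sqrt (\sum_(a < q) cnorm2 (v a 0)).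

(* operator norm (w.r.t. the Euclidean norm on C^q) *)
Definition opnorm (M : 'M[R[i]]_q) : R :=
  sup [set cvnorm (M *m v) | v in [set v | cvnorm v = 1]].

(* Omega_* = { tau : ||U(tau)|| < pi } *)
Definition Omega : set 'rV[R]_m := [set tau | opnorm (Umat tau) < pi].

(* spectral functional calculus for a Hermitian matrix H and f : R -> R:
   f(H) is the matrix acting as f(lambda) on each eigenvector of H with
   (real) eigenvalue lambda. *)
Definition herm_fun (f : R -> R) (H : 'M[R[i]]_q) : 'M[R[i]]_q :=
  xget 0 [set F | forall (lam : R) (v : 'cV[R[i]]_q),
                   H *m v = toC lam *: v -> F *m v = toC (f lam) *: v].

(* z cot z, extended by continuity (value 1) at z = 0 *)
Definition zcotz (z : R) : R := if z == 0 then 1 else z * cos z / sin z.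

(* phi((x,t); tau) = <U(tau) cot U(tau) x, x> + 4 t . tau *)
Definition phi (g : grp) (tau : 'rV[R]_m) : R :=
  let xc := (map_mx toC g.1)^T in
  complex.Re (\sum_(a < q) (herm_fun zcotz (Umat tau) *m xc) a 0 * (xc a 0)^*)
  + 4 * \sum_(j < m) g.2 0 j * tau 0 j.

Local Close Scope complex_scope.

(* ---------- gradient and Hessian in tau ---------- *)
Definition ej (j : 'I_m) : 'rV[R]_m := delta_mx 0 j.
Definition partial (j : 'I_m) (f : 'rV[R]_m -> R) : 'rV[R]_m -> R :=
  fun tau => 'D_(ej j) f tau.
Definition hessian (f : 'rV[R]_m -> R) (tau : 'rV[R]_m) : 'M[R]_m :=
  \matrix_(i < m, j < m) partial i (partial j f) tau.

Definition nondeg_crit (g : grp) (theta : 'rV[R]_m) : Prop :=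
  [/\ Omega theta, (forall j, partial j (phi g) theta = 0) &
      \det (hessian (phi g) theta) != 0].

(* the set M *)
Definition Mset : set grp := [set g | exists theta, nondeg_crit g theta].

End Defs.

(* Main.v *)
(* In an eigenbasis of U(tau), with eigenvalues of modulus < pi, the sum of
   l cot (l s) |x_l|^2 and 4 t . tau solves a Hamilton-Jacobi equation in the time s.
   Its increment along a horizontal curve is controlled by completing a square in each
   eigendirection, which gives phi(g; tau) <= L^2 for every tau in Omega_* and every
   horizontal curve from o to g of length L. Conversely, for theta in Omega_* and an
   endpoint x0 there is an explicit curve of constant speed c, ending at some (x0, T),
   with phi((x0, T); theta) = c^2. By the first part theta is a local maximum of
   phi((x0, T); .), hence a critical point; comparing gradients, a critical point theta
   of phi((x0, t0); .) has T = t0, so that this curve ends at (x0, t0) and both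
   equalities follow. Differentiability of phi at theta comes from divided differences
   of z cot z and the continuity of the spectral calculus. *)
Require Import Defs.
From HB Require Import structures.
From mathcomp Require Import all_boot all_order all_algebra.
From mathcomp Require Import all_classical all_reals all_analysis.
From mathcomp Require Import measurable_realfun complex ring lra.
Import Order.TTheory GRing.Theory Num.Theory.
Import numFieldNormedType.Exports.
Local Open Scope classical_set_scope.
Local Open Scope ring_scope.
Set Implicit Arguments.
Unset Strict Implicit.
Unset Printing Implicit Defensive.

(** Two obstacles shape the proof. A competing curve is differentiable only almost everywhere and
    may stand still, so it is not reparametrized: a time [w] whose derivative dominates the speed
    off a null set takes the place of arc length. On the null set only the monotonicity of [w] is
    used, so the value function along the curve is bounded from below only, by a covering argument
    on increments; this suffices because l cot (l s) decreases in s. A small positive [w 0] avoids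
    the pole at s = 0. On the side of phi, the eigenbases supplied by the spectral theorem have no
    regularity in tau, so nothing is differentiated through them: an exact formula with divided
    differences compares the functional calculi of two nearby matrices in two unrelated eigenbases.
    Differentiability has to be proved because [partial] carries no information where the difference
    quotients have no limit. The gradients for two endpoints over the same x0 can be compared
    because t enters phi only through the linear term 4 t . tau. *)

(** * Functional calculus of Hermitian matrices *)

Section HermitianCalculus.
Variables (R : realType) (q : nat).
Local Notation C := R[i].
Local Open Scope complex_scope.
Implicit Types (H F : 'M[C]_q) (f : R -> R).

Definition adj (n p : nat) (A : 'M[C]_(n, p)) : 'M[C]_(p, n) := map_mx conjc A^T.

Lemma adjE n p (A : 'M[C]_(n, p)) i j : adj A i j = (A j i)^*.
Proof. by rewrite !mxE. Qed.

Lemma toC_inj : injective (@toC R).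
Proof. by move=> a b [->]. Qed.

Definition specdec H (P : 'M[C]_q) (lam : 'I_q -> R) :=
  [/\ P *m adj P = 1%:M, adj P *m P = 1%:M &
      H = adj P *m diag_mx (\row_k toC (lam k)) *m P].

Lemma hermitian_specdec H : adj H = H -> exists P lam, specdec H P lam.
Proof.
move=> Hh; have Hh' : H \is hermsymmx.
  by apply/is_hermitianmxP; rewrite expr0 scale1r -[LHS]Hh; apply/matrixP=> i j; rewrite !mxE.
have P1 : spectralmx H *m adj (spectralmx H) = 1%:M.
  exact/unitarymxP/spectral_unitarymx.
have PU := spectral_unit H.
have /hermitian_normalmx /orthomx_spectralP := Hh'.
have := hermitian_spectral_diag_real Hh'.
move: (spectralmx H) (spectral_diag H) P1 PU => P sp P1 PU /mxOverP spR HE.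
exists P, (fun k => complex.Re (sp 0 k)); split => //; first exact: mulmx1C.
have -> : adj P = invmx P by rewrite -[adj P]mul1mx -(mulVmx PU) -mulmxA P1 mulmx1.
rewrite HE; congr (_ *m diag_mx _ *m _); apply/rowP => k; rewrite mxE.
exact/esym/RRe_real.
Qed.

Definition fcalc f (P : 'M[C]_q) (lam : 'I_q -> R) : 'M[C]_q :=
  adj P *m diag_mx (\row_k toC (f (lam k))) *m P.

(** In the coordinates [P *m v] the eigenvalue equation reads (lam k - mu) (P v)_k = 0, so
    [f (lam k)] may be replaced by [f mu] wherever the coordinate is nonzero. *)
Lemma fcalc_eigen f H P lam (mu : R) (v : 'cV[C]_q) : specdec H P lam ->
  H *m v = toC mu *: v -> fcalc f P lam *m v = toC (f mu) *: v.
Proof.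
move=> [P1 P2 ->] E.
have Ek k : toC (lam k) * (P *m v) k 0 = toC mu * (P *m v) k 0.
  have := congr1 (mulmx P) E; rewrite !mulmxA P1 mul1mx => /matrixP/(_ k 0).
  by rewrite -scalemxAr -mulmxA mul_diag_mx !mxE.
rewrite /fcalc -[RHS]mul1mx -P2 -!mulmxA; congr (_ *m _).
rewrite -scalemxAr mul_diag_mx; apply/matrixP => k j; rewrite ord1 !mxE.
have := Ek k; rewrite !mxE; set w := \sum_ _ _.
have [->|wn0] := eqVneq w 0; first by rewrite !mulr0.
by move=> /(mulIf wn0)/toC_inj ->.
Qed.

Lemma col_mulmx (K : pzRingType) n p r (A : 'M[K]_(n, p)) (B : 'M[K]_(p, r)) j :
  col j (A *m B) = A *m col j B.
Proof. by apply/matrixP => i k; rewrite !mxE; apply: eq_bigr => l _; rewrite !mxE. Qed.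

(** The columns of [adj P] are eigenvectors of [H], and they determine [F] because [adj P] is
    invertible. *)
Lemma fcalc_unique f H P lam F : specdec H P lam ->
  (forall (mu : R) (v : 'cV[C]_q), H *m v = toC mu *: v ->
    F *m v = toC (f mu) *: v) -> F = fcalc f P lam.
Proof.
move=> sd FP; have [P1 P2 HE] := sd.
suff E : F *m adj P = fcalc f P lam *m adj P.
  by rewrite -[F]mulmx1 -P2 mulmxA E -mulmxA P2 mulmx1.
apply/matrixP => i k.
have Ev : H *m col k (adj P) = toC (lam k) *: col k (adj P).
  rewrite -col_mulmx {1}HE -!mulmxA P1 mulmx1.
  apply/matrixP => a b; rewrite mxE mul_mx_diag !mxE.
  by rewrite mulrC.
have := FP _ _ Ev; rewrite -(fcalc_eigen f sd Ev) -!col_mulmx.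
by move=> /matrixP/(_ i 0); rewrite !mxE.
Qed.

(** Existence and uniqueness make the choice in [herm_fun] harmless: its default value 0 is never
    taken for lack of a candidate. *)
Lemma herm_funE f H P lam : specdec H P lam -> herm_fun f H = fcalc f P lam.
Proof.
move=> sd; rewrite /herm_fun.
case: xgetP => [F _ /= FP|/(_ (fcalc f P lam))]; first exact: fcalc_unique sd FP.
by case=> mu v; exact: fcalc_eigen sd.
Qed.

Definition conjm n p (A : 'M[C]_(n, p)) : 'M[C]_(n, p) := map_mx conjc A.

Lemma conjmK n p : involutive (@conjm n p).
Proof. by move=> A; apply/matrixP => i j; rewrite !mxE conjcK. Qed.

Lemma conjmM n p r (A : 'M[C]_(n, p)) (B : 'M[C]_(p, r)) :
  conjm (A *m B) = conjm A *m conjm B.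
Proof. exact: map_mxM. Qed.

(* If conj H = - H, an even function of H is real and an odd one is imaginary. *)
Lemma fcalc_conj f (s : R) H P lam : specdec H P lam -> conjm H = - H ->
  (forall z, f (- z) = s * f z) -> conjm (fcalc f P lam) = toC s *: fcalc f P lam.
Proof.
move=> sd Hc fs.
have Rc (r : R) (v : 'cV[C]_q) : conjm (toC r *: v) = toC r *: conjm v.
  by apply/matrixP => i j; rewrite !mxE rmorphM /= oppr0.
have -> : toC s *: fcalc f P lam = fcalc (fun z => s * f z) P lam.
  rewrite /fcalc -!mulmxA scalemxAr scalemxAl; congr (_ *m (_ *m _)); apply/matrixP => i j.
  by rewrite !mxE mulrnAr -rmorphM.
apply: (fcalc_unique sd) => mu v Hv.
(* Since conj H = - H, the conjugate of an eigenvector for [mu] is an eigenvector for [- mu]. *)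
rewrite -[v in LHS]conjmK -conjmM (fcalc_eigen (mu := - mu) _ sd) ?Rc ?conjmK ?fs //.
rewrite -[H]opprK -Hc mulNmx -conjmM Hv Rc.
by apply/matrixP => i j; rewrite !mxE /toC rmorphN /= mulNr.
Qed.

End HermitianCalculus.

(** * Real coordinates in an eigenbasis of U(tau) *)

Section Frames.
Variables (R : realType) (q m : nat) (U : 'I_m -> 'M[R]_q).
Hypothesis hskew : skew_family U.
Local Notation C := R[i].
Local Open Scope complex_scope.

Definition dotr n (u v : 'rV[R]_n) : R := \sum_a u 0 a * v 0 a.

Lemma Umat_entry tau a b :
  Umat U tau a b = 0 +i* (\sum_j tau 0 j * U j a b).
Proof.
rewrite !mxE summxE.
under eq_bigr => j _ do rewrite !mxE /toC -rmorphM.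
rewrite -raddf_sum /=.
by apply/eqP; rewrite eq_complex /= !(mul0r, mulr0, mul1r, mulr1, subr0, add0r, oppr0, eqxx).
Qed.

Lemma skew_entry j a b : U j a b = - U j b a.
Proof. by have /matrixP/(_ b a) := hskew j; rewrite !mxE. Qed.

Lemma Umat_adj tau : adj (Umat U tau) = Umat U tau.
Proof.
apply/matrixP => a b; rewrite adjE !Umat_entry /=; congr (_ +i* _).
by rewrite -sumrN; apply: eq_bigr => j _; rewrite [U j a b]skew_entry mulrN.
Qed.

Lemma Umat_conj tau : conjm (Umat U tau) = - Umat U tau.
Proof.
apply/matrixP => a b; rewrite [LHS]mxE [RHS]mxE Umat_entry /=.
by apply/eqP; rewrite eq_complex /= oppr0 !eqxx.
Qed.

Definition rerow (P : 'M[C]_q) (k : 'I_q) : 'rV[R]_q := \row_b complex.Re (P k b).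
Definition imrow (P : 'M[C]_q) (k : 'I_q) : 'rV[R]_q := \row_b complex.Im (P k b).
Definition tocol (x : 'rV[R]_q) : 'cV[C]_q := (map_mx (@toC R) x)^T.

Lemma mul_tocol (P : 'M[C]_q) x k :
  (P *m tocol x) k 0 = dotr (rerow P k) x +i* dotr (imrow P k) x.
Proof.
rewrite mxE (_ : \sum_j _ = \sum_b (complex.Re (P k b) * x 0 b +i* (complex.Im (P k b) * x 0 b))).
  rewrite /dotr; elim/big_ind3 : _ => [//|? ? ? ? ? ? -> -> //|b _].
  by rewrite !mxE.
apply: eq_bigr => b _; rewrite !mxE; case: (P k b) => u v /=.
by apply/eqP; rewrite eq_complex /= !mulr0 subr0 add0r !eqxx.
Qed.


Lemma conjmD n p (A B : 'M[C]_(n, p)) : conjm (A + B) = conjm A + conjm B.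
Proof. exact: map_mxD. Qed.

Lemma adjM n p r (A : 'M[C]_(n, p)) (B : 'M[C]_(p, r)) :
  adj (A *m B) = adj B *m adj A.
Proof. by rewrite /adj trmx_mul map_mxM. Qed.

Lemma conjm_tocol x : conjm (tocol x) = tocol x.
Proof. by apply/matrixP => i j; rewrite !mxE /= oppr0. Qed.

Lemma fcalc_form (f : R -> R) (P : 'M[C]_q) lam x y :
  (adj (tocol y) *m (fcalc f P lam *m tocol x)) 0 0 =
  \sum_k toC (f (lam k)) * (((P *m tocol y) k 0)^* * (P *m tocol x) k 0).
Proof.
rewrite /fcalc -2!mulmxA mulmxA -adjM mxE.
apply: eq_bigr => k _; rewrite adjE mul_diag_mx.
by rewrite [X in _ * X]mxE [X in _ * (X * _)]mxE mulrCA.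
Qed.

(* [al k] and [be k] are the real and imaginary parts of the rows of an eigenbasis
   of [U(tau)]. In [frame_fun], [y] is [(e + i o)(U(tau)) x], which is real because
   [conj U(tau) = - U(tau)], so that its coordinates are those of [x] multiplied by
   [e (lam k) + i o (lam k)]. *)
Record is_frame (tau : 'rV[R]_m) (lam : 'I_q -> R) (al be : 'I_q -> 'rV[R]_q)
    : Prop := IsFrame {
  frame_dotr : forall x y, dotr x y =
    \sum_k (dotr (al k) x * dotr (al k) y + dotr (be k) x * dotr (be k) y);
  frame_brk : forall x y, dotr tau (brk U x y) =
    \sum_k lam k * (dotr (be k) x * dotr (al k) y - dotr (al k) x * dotr (be k) y);
  frame_phi : forall g, phi U g tau =
    \sum_k zcotz (lam k) * (dotr (al k) g.1 ^+ 2 + dotr (be k) g.1 ^+ 2)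
    + 4 * dotr tau g.2;
  frame_fun : forall (e o : R -> R) x,
    (forall z, e (- z) = e z) -> (forall z, o (- z) = - o z) ->
    forall y, y = \sum_k
       ((e (lam k) * dotr (al k) x - o (lam k) * dotr (be k) x) *: al k
      + (o (lam k) * dotr (al k) x + e (lam k) * dotr (be k) x) *: be k) ->
    forall k, dotr (al k) y = e (lam k) * dotr (al k) x - o (lam k) * dotr (be k) x
      /\ dotr (be k) y = o (lam k) * dotr (al k) x + e (lam k) * dotr (be k) x }.

Lemma dotrC n (u v : 'rV[R]_n) : dotr u v = dotr v u.
Proof. by apply: eq_bigr => a _; rewrite mulrC. Qed.

Lemma specdec_frame tau P lam : specdec (Umat U tau) P lam ->
  is_frame tau lam (rerow P) (imrow P).
Proof.
move=> sd; have [P1 P2 HE] := sd.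
have ReS (F : 'I_q -> C) : complex.Re (\sum_k F k) = \sum_k complex.Re (F k).
  by apply: big_morph => // -[? ?] [? ?].
have ImS (F : 'I_q -> C) : complex.Im (\sum_k F k) = \sum_k complex.Im (F k).
  by apply: big_morph => // -[? ?] [? ?].
split.
- move=> x y; have -> : dotr x y = complex.Re ((adj (tocol x) *m tocol y) 0 0).
    rewrite mxE ReS; apply: eq_bigr => a _; rewrite adjE !mxE /=.
    ring.
  rewrite -[tocol y]mul1mx -P2 -mulmxA mulmxA -adjM mxE ReS.
  apply: eq_bigr => k _; rewrite adjE !mul_tocol /=.
  by rewrite mulNr opprK.
- move=> x y.
  have -> : dotr tau (brk U x y) = complex.Im ((adj (tocol y) *m (Umat U tau *m tocol x)) 0 0).
    rewrite mxE ImS /dotr.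
    under eq_bigr do rewrite mxE mulr_sumr.
    rewrite exchange_big /=; apply: eq_bigr => a _.
    rewrite adjE [(Umat _ _ *m _) _ _]mxE.
    have -> : ((tocol y) a 0)^* = toC (y 0 a) by rewrite !mxE /= oppr0.
    have -> (z : C) : complex.Im (toC (y 0 a) * z) = y 0 a * complex.Im z.
      by case: z => u v /=; rewrite mul0r addr0.
    rewrite ImS mulr_sumr; under eq_bigr do rewrite mulr_sumr.
    rewrite exchange_big /=; apply: eq_bigr => b _.
    rewrite Umat_entry !mxE /= mul0r add0r mulr_suml mulr_sumr.
    by apply: eq_bigr => j _; ring.
  rewrite {1}HE -[_ *m _ *m P]/(fcalc id P lam) fcalc_form ImS.
  apply: eq_bigr => k _; rewrite !mul_tocol /=; ring.
- move=> g; rewrite /phi; congr (_ + 4 * _); last by rewrite [RHS]dotrC.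
  rewrite (herm_funE (@zcotz R) sd).
  set z := \sum_(a < q) _; have -> : z = (adj (tocol g.1) *m (fcalc (@zcotz R) P lam *m tocol g.1)) 0 0.
    rewrite mxE; apply: eq_bigr => a _; rewrite adjE mulrC; congr (_ * _).
  rewrite fcalc_form ReS; apply: eq_bigr => k _; rewrite !mul_tocol /=; ring.
- move=> e o x ee oo y yE.
  have Ex (f : R -> R) (c : R) : (forall z, f (- z) = c * f z) -> exists2 F : 'M[C]_q,
      forall k, (P *m (F *m tocol x)) k 0 = toC (f (lam k)) * (P *m tocol x) k 0 &
      conjm F = toC c *: F.
    move=> fc; exists (fcalc f P lam); last exact: fcalc_conj sd (Umat_conj tau) fc.
    move=> k; rewrite /fcalc -!mulmxA (mulmxA P (adj P)) P1 mul1mx mul_diag_mx mxE.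
    by rewrite [X in X * _]mxE.
  have e1 z : e (- z) = 1 * e z by rewrite mul1r.
  have o1 z : o (- z) = -1 * o z by rewrite mulN1r.
  have [E PE Ec] := Ex e 1 e1; have [D PD Dc] := Ex o (-1) o1.
  (* By parity [E] is real and [D] purely imaginary, so [G] is a real matrix and maps the real
     vector x to a real vector, which is then identified with [y]. *)
  set G := E + 'i *: D.
  pose w k : C := (toC (e (lam k)) + 'i * toC (o (lam k))) * (P *m tocol x) k 0.
  have wE k : w k = (e (lam k) * dotr (rerow P k) x - o (lam k) * dotr (imrow P k) x)
     +i* (o (lam k) * dotr (rerow P k) x + e (lam k) * dotr (imrow P k) x).
    rewrite /w mul_tocol; apply/eqP; rewrite eq_complex /=; apply/andP; split; apply/eqP; ring.
  have GE : P *m (G *m tocol x) = \col_k w k.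
    rewrite /G mulmxDl mulmxDr -(scalemxAl 'i) -(scalemxAr 'i).
    move: (P *m (E *m tocol x)) (P *m (D *m tocol x)) PE PD => A B HA HB.
    apply/matrixP => k j; rewrite ord1 [LHS]mxE HA [X in _ + X]mxE HB [RHS]mxE.
    by rewrite /w mulrDl mulrA.
  have Gc : conjm (G *m tocol x) = G *m tocol x.
    rewrite conjmM conjm_tocol; congr (_ *m _).
    have cs : conjm ('i *: D) = - 'i *: conjm D.
      by apply/matrixP => a b; rewrite !mxE rmorphM /=; congr (_ * _); apply/eqP; rewrite eq_complex /= oppr0 !eqxx.
    rewrite /G conjmD cs Ec Dc.
    have -> : toC (-1 : R) = -1 by rewrite /toC rmorphN.
    by rewrite scaleNr scaleN1r scalerN opprK scale1r.
  have yG : tocol y = G *m tocol x.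
    apply/matrixP => b j; rewrite ord1 [LHS]mxE [LHS]mxE.
    have := congr1 (fun A : 'cV_q => complex.Im (A b 0)) Gc; rewrite mxE.
    have : complex.Re ((G *m tocol x) b 0) = y 0 b.
      rewrite -[G *m _]mul1mx -P2 -mulmxA GE mxE ReS yE summxE.
      apply: eq_bigr => k _; rewrite adjE !mxE wE; case: (P k b) => u v /=; ring.
    case: ((G *m tocol x) b 0) => u v /= -> vN.
    by rewrite /toC; congr (_ +i* _); lra.
  move=> k; have := GE; rewrite -yG => /matrixP/(_ k 0).
  by rewrite mul_tocol [RHS]mxE wE => -[-> ->].
Qed.

Lemma cnorm2E (z : C) : toC (cnorm2 z) = z^* * z.
Proof.
by case: z => a b; apply/eqP; rewrite eq_complex /cnorm2 /=; apply/andP; split; apply/eqP; ring.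
Qed.

Lemma cnorm2_ge0 (z : C) : 0 <= cnorm2 z.
Proof. by rewrite addr_ge0 ?sqr_ge0. Qed.

Lemma cnorm2Z (r : R) (z : C) : cnorm2 (toC r * z) = r ^+ 2 * cnorm2 z.
Proof. by case: z => a b; rewrite /cnorm2 /=; ring. Qed.

Lemma sum_cnorm2 (v : 'cV[C]_q) : toC (\sum_a cnorm2 (v a 0)) = (adj v *m v) 0 0.
Proof.
rewrite mxE /toC rmorph_sum; apply: eq_bigr => a _.
by rewrite adjE -cnorm2E.
Qed.

Lemma opnorm_eigen (H P : 'M[C]_q) lam : specdec H P lam ->
  forall k, `|lam k| <= opnorm H.
Proof.
move=> sd; have [P1 P2 HE] := sd => k.
have PN (v : 'cV[C]_q) : \sum_a cnorm2 ((P *m v) a 0) = \sum_a cnorm2 (v a 0).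
  by apply: (@toC_inj R); rewrite !sum_cnorm2 adjM -mulmxA (mulmxA (adj P)) P2 mul1mx.
have HN (v : 'cV[C]_q) : \sum_a cnorm2 ((H *m v) a 0) =
    \sum_a lam a ^+ 2 * cnorm2 ((P *m v) a 0).
  rewrite -PN {1}HE -!mulmxA (mulmxA P) P1 mul1mx.
  by apply: eq_bigr => a _; rewrite mul_diag_mx mxE [X in X * _]mxE cnorm2Z.
have Pk : P *m col k (adj P) = col k 1%:M by rewrite -col_mulmx P1.
have S1 (F : 'I_q -> R) : \sum_a F a * cnorm2 ((col k 1%:M : 'cV[C]_q) a 0) = F k.
  rewrite (bigD1 k) //= big1 => [|a ak]; rewrite !mxE ?eqxx ?(negbTE ak) /cnorm2 /=.
    by rewrite expr1n expr0n /= !addr0 mulr1.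
  by rewrite expr0n /= addr0 mulr0.
apply: ub_le_sup.
  (* Any finite bound will do: it ensures that the supremum defining [opnorm] is a true one.
     Coordinates of a unit vector have modulus at most 1. *)
  exists (Num.sqrt (\sum_a lam a ^+ 2)) => _ /= [v v1 <-].
  rewrite /cvnorm ler_wsqrtr // HN; apply: ler_sum => a _.
  rewrite ler_piMr ?sqr_ge0 //.
  have <- : \sum_a cnorm2 (v a 0) = 1.
    have := congr1 (fun z => z ^+ 2) v1; rewrite /= /cvnorm sqr_sqrtr ?expr1n //.
    by apply: sumr_ge0 => *; exact: cnorm2_ge0.
  rewrite -PN (bigD1 a) //= lerDl; apply: sumr_ge0 => *; exact: cnorm2_ge0.
exists (col k (adj P)); rewrite /= /cvnorm.
  rewrite -PN Pk; under eq_bigr do rewrite -[cnorm2 _]mul1r.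
  by rewrite (S1 (fun=> 1)) sqrtr1.
by rewrite HN Pk (S1 (fun a => lam a ^+ 2)) sqrtr_sqr.
Qed.

Lemma Umat_frame tau : exists lam al be, is_frame tau lam al be /\
  (Omega U tau -> forall k, `|lam k| < pi).
Proof.
have [P [lam sd]] := hermitian_specdec (Umat_adj tau).
exists lam, (rerow P), (imrow P); split; first exact: specdec_frame.
by move=> Ot k; apply: le_lt_trans Ot; exact: (opnorm_eigen sd).
Qed.

End Frames.

(** * Monotonicity from pointwise estimates off a null set *)

Section Monotonicity.
Variable R : realType.
Local Notation mu := (@lebesgue_measure R).

(** Continuous induction: an interval straddling the supremum S of the v with [Q 0 v] carries the
    property past S unless S = 1. *)
Lemma cousin (Q : R -> R -> Prop) :
  (forall a b c, 0 <= a -> a <= b -> b <= c -> c <= 1 -> Q a b -> Q b c -> Q a c) ->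
  (forall s, 0 <= s -> s <= 1 -> exists2 d, 0 < d & forall u v,
     0 <= u -> u <= s -> s <= v -> v <= 1 -> s - d < u -> v < s + d -> Q u v) ->
  Q 0 1.
Proof.
move=> Qtrans Qloc.
pose A := [set v : R | [/\ 0 <= v, v <= 1 & Q 0 v]].
have A0 : A 0.
  split; rewrite ?lexx ?ler01 //.
  have [d d0 /(_ 0 0)] := Qloc 0 (lexx 0) ler01.
  by rewrite lexx ler01 sub0r add0r oppr_lt0 d0; apply.
have Aub : ubound A 1 by move=> v [].
have Asup : has_sup A by split; [exists 0 | exists 1].
set S := sup A.
have S0 : 0 <= S by apply: ub_le_sup => //; exists 1.
have S1 : S <= 1 by apply: ge_sup => //; exists 0.
have [d d0 dQ] := Qloc S S0 S1.
have [u [u0 u1 Qu] uS] := @sup_adherent _ A d d0 Asup.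
have uleS : u <= S by apply: ub_le_sup => //; exists 1.
pose v := Num.min 1 (S + d / 2).
have Sv : S <= v by rewrite le_min S1 lerDl divr_ge0 // ltW.
have v1 : v <= 1 by rewrite ge_min lexx.
have Av : A v.
  split => //; first exact: le_trans Sv.
  apply: (Qtrans _ u) => //; first exact: le_trans Sv.
  apply: dQ => //; rewrite gt_min; apply/orP; right.
  by rewrite ltrD2l; lra.
have vS : v <= S by apply: ub_le_sup => //; exists 1.
have v1' : v = 1.
  by move: vS; rewrite ge_min => /orP[?|]; [apply/le_anti; rewrite v1; lra | lra].
by case: Av => _ _; rewrite v1'.
Qed.

Lemma le_lebesgue (A B : set R) :
  measurable A -> measurable B -> A `<=` B -> (mu A <= mu B)%E.
Proof. by move=> mA mB AB; apply: (@le_measure _ _ _ mu A B); try exact: mem_set. Qed.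

(** [V] is an open set of measure less than [d] around [N], and [W v] is the measure of its part in
    ]0, v]. The increments of [W] are a budget that pays for the length of disjoint intervals inside
    [V]. *)
Lemma null_cover (N : set R) (d : R) : mu.-negligible N -> 0 < d ->
  exists V : set R, exists W : R -> R, [/\ open V, N `<=` V,
    forall u v : R, 0 <= u -> u <= v -> v <= 1 -> W u <= W v,
    forall u v : R, 0 <= u -> u <= v -> v <= 1 -> (forall s : R, u < s <= v -> V s) ->
      v - u <= W v - W u & W 1 - W 0 < d].
Proof.
move=> [B [mB B0 NB]] d0.
have B0' : mu B = 0%E by [].
have Bfin : (mu B < +oo)%E by rewrite B0'.
have [V [oO BO mO]] := @lebesgue_regularity_outer R B d mB Bfin d0.
have mO' : measurable V by exact: open_measurable.
have muO : (mu V < d%:E)%E.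
  rewrite -(setDUK BO) measureU //; last 2 first.
  - exact: measurableD.
  - by rewrite -subset0 => s [Bs [_ nBs]].
  by rewrite [X in (X + _)%E]B0' add0e.
pose OI (v : R) : set R := V `&` [set` `]0, v]].
have mOI v : measurable (OI v) by apply: measurableI => //; exact: measurable_itv.
have OIfin v : mu (OI v) \is a fin_num.
  rewrite ge0_fin_numE //; apply: (le_lt_trans _ (lt_trans muO (ltry d))).
  by apply: le_lebesgue => // s [].
exists V, (fun v => fine (mu (OI v))); split => //.
- exact: subset_trans BO.
- move=> u v u0 uv v1; apply: fine_le => //; apply: le_lebesgue => //.
  move=> s [Vs]; rewrite /= in_itv /= => /andP[s0 su].
  by split => //=; rewrite in_itv /= s0 (le_trans su).
- move=> u v u0 uv v1 uvO.
  have E : OI v = OI u `|` [set` `]u, v]].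
    rewrite eqEsubset; split => s /=; rewrite /OI /= !in_itv /=.
      move=> [Os /andP[s0 sv]]; have [su|us] := leP s u; [left|right] => //.
      by rewrite s0.
    move=> [[Os /andP[s0 su]]|/andP[us sv]].
      by split => //; rewrite s0 (le_trans su).
    split; first by apply: uvO; rewrite us sv.
    by rewrite sv (le_lt_trans u0).
  have -> : mu (OI v) = (mu (OI u) + (v - u)%:E)%E.
    rewrite E measureU //.
    + have := @lebesgue_measure_itv R `]u, v]; rewrite /= lte_fin => ->.
      by case: ltgtP uv => // -> _; rewrite subrr.
    + exact: mOI.
    + rewrite -subset0 => s [] /= []; rewrite !in_itv /= => _ /andP[_ su] /andP[us _].
      by have := lt_le_trans us su; rewrite ltxx.
  by rewrite fineD //=; lra.
- have -> : mu (OI 0) = 0%E.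
    rewrite (_ : OI 0 = set0) ?measure0 // -subset0 => s [] _ /=.
    by rewrite in_itv /= => /andP[s0 s1]; have := lt_le_trans s0 s1; rewrite ltxx.
  rewrite /= subr0 -lte_fin fineK //; apply: le_lt_trans muO.
  by apply: le_lebesgue => // s [].
Qed.


(* Near a null set the increments of [F] are only controlled by those of [x] and
   [t], whose sum over a short disjoint family is small. *)
Lemma abs_cont_nondecreasing (V W : normedModType R) (x : R -> V) (t : R -> W)
    (F : R -> R) (K : R) (N : set R) :
  abs_cont x 0 1 -> abs_cont t 0 1 -> 0 <= K ->
  (forall u v : R, 0 <= u -> u <= v -> v <= 1 ->
     - (K * (`|x v - x u| + `|t v - t u|)) <= F v - F u) ->
  mu.-negligible N ->
  (forall s : R, 0 <= s -> s <= 1 -> ~ N s -> forall eta : R, 0 < eta ->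
     exists2 d : R, 0 < d & forall u v : R, 0 <= u -> u <= s -> s <= v -> v <= 1 ->
       s - d < u -> v < s + d -> - (eta * (v - u)) <= F v - F u) ->
  F 0 <= F 1.
Proof.
move=> acx act K0 FK negN Fd.
rewrite leNgt; apply/negP => F01.
set e := F 0 - F 1; have e0 : 0 < e by rewrite subr_gt0.
have K1 : 0 < K + 1 by lra.
(* With this choice the bad intervals cost at most K (e' + e') <= e / 2, and the others at most e /
   4, together less than the supposed drop e. *)
pose e' := e / 4 / (K + 1).
have e'0 : 0 < e' by rewrite !divr_gt0.
have [dx dx0 acx'] := acx e' e'0.
have [dt dt0 act'] := act e' e'0.
have mind : 0 < Num.min dx dt by rewrite lt_min dx0.
have [V0 [G [oV NV Gmono Glen G1]]] := @null_cover N (Num.min dx dt) negN mind.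
move: G1; rewrite lt_min => /andP[Gx Gt].
pose len (l : seq (R * R)) := \sum_(p <- l) (p.2 - p.1).
pose var (l : seq (R * R)) := \sum_(p <- l) (`|x p.2 - x p.1| + `|t p.2 - t p.1|).
(* [l] lists the disjoint intervals around points of [N]; their length is charged to [G], while
   outside them [F] loses at most e / 4 per unit of length. Such lists concatenate, so [cousin]
   applies. *)
pose Q a b := exists l : seq (R * R),
  [/\ all (fun p => [&& a <= p.1, p.1 <= p.2 & p.2 <= b]) l,
      pairwise (fun p r : R * R => p.2 <= r.1) l,
      len l <= G b - G a &
      - (e / 4 * (b - a)) - K * var l <= F b - F a].
have : Q 0 1.
  apply: cousin => [a b c a0 ab bc c1 [l [l1 l2 l3 l4]] [l' [l1' l2' l3' l4']]|s s0 s1].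
    exists (l ++ l'); rewrite /len /var all_cat pairwise_cat !big_cat /= l2 l2' !andbT.
    split.
    - apply/andP; split.
        by apply: sub_all l1 => p /and3P[-> -> /= pb]; exact: le_trans bc.
      by apply: sub_all l1' => p /and3P[bp -> ->]; rewrite (le_trans ab bp).
    - apply/allrelP => p r pl rl; have /allP/(_ _ pl)/and3P[_ _ pb] := l1.
      by have /allP/(_ _ rl)/and3P[br _ _] := l1'; exact: le_trans br.
    - by move: l3 l3'; rewrite /len => l3 l3'; lra.
    - by move: l4 l4'; rewrite /var => l4 l4'; lra.
  have [Ns|Ns] := pselect (N s).
    have /nbhs_ballP[d /= d0 dV] : nbhs s V0 by apply: open_nbhs_nbhs; split => //; exact: NV.
    exists d => // u v u0 us sv v1 du dv.
    have uv : u <= v by exact: le_trans sv.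
    exists [:: (u, v)]; rewrite /len /var !big_seq1 /= lexx uv lexx; split => //.
      apply: Glen => // z /andP[uz zv]; apply: dV; rewrite /ball /= ltr_distlC.
      by apply/andP; split; lra.
    have := FK u v u0 uv v1; have : 0 <= e / 4 * (v - u) by rewrite mulr_ge0 // ?subr_ge0 //; lra.
    lra.
  have [|d d0 Fd'] := Fd s s0 s1 Ns (e / 4); first lra.
  exists d => // u v u0 us sv v1 du dv.
  have uv : u <= v by exact: le_trans sv.
  exists [::]; rewrite /len /var !big_nil mulr0 subr0; split => //.
    by rewrite subr_ge0; exact: Gmono.
  exact: Fd'.
move=> [l [l1 l2 l3 l4]].
pose n := size l.
pose lft (k : 'I_n) := (nth (0, 0) l k).1.
pose rgt (k : 'I_n) := (nth (0, 0) l k).2.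
have A1 k : 0 <= lft k /\ lft k <= rgt k /\ rgt k <= 1.
  by have /allP/(_ _ (mem_nth (0, 0) (ltn_ord k)))/and3P[] := l1.
have A2 (k k' : 'I_n) : k != k' -> rgt k <= lft k' \/ rgt k' <= lft k.
  move=> kk'; have /(pairwiseP (0, 0)) H := l2.
  have : (k < k')%N \/ (k' < k)%N.
    by move: kk'; rewrite -val_eqE /=; case: ltngtP => //; [left|right].
  by case => h; [left|right]; apply: H => //; rewrite inE; exact: ltn_ord.
have A3 : \sum_(k < n) (rgt k - lft k) <= G 1 - G 0.
  by apply: le_trans l3; rewrite /len (big_nth (0, 0)) big_mkord.
have Vx := acx' n lft rgt A1 A2 (le_lt_trans A3 Gx).
have Vt := act' n lft rgt A1 A2 (le_lt_trans A3 Gt).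
have Vl : var l < e' + e'.
  by rewrite /var (big_nth (0, 0)) big_mkord big_split /= ltrD.
have KV : K * var l <= K * (e' + e') by rewrite ler_wpM2l // ltW.
have Ke : (K + 1) * e' = e / 4 by rewrite /e' mulrC divfK // gt_eqF.
have : K * (e' + e') <= e / 2 by rewrite mulrDr; move: Ke; rewrite mulrDl mul1r; lra.
by rewrite subr0 mulr1 /e in l4 *; move: KV e0 l4; rewrite /e; lra.
Qed.

End Monotonicity.

(** * The functions sin (l p) / l and l cot (l p) *)

Section Trigonometry.
Variable R : realType.
Implicit Types l p r : R.

(** The solution of y'' + l ^ 2 y = 0 with y 0 = 0 and y' 0 = 1. Then [ctg l p] is l cot (l p), with
    value 1 / p at l = 0, and zero eigenvalues need no separate treatment. *)
Definition sn l p : R := if l == 0 then p else sin (l * p) / l.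
Definition ctg l p : R := cos (l * p) / sn l p.

Lemma sin_sn l p : sin (l * p) = l * sn l p.
Proof. by rewrite /sn; case: eqVneq => [->|l0]; rewrite ?mul0r ?sin0 // mulrCA divff // mulr1. Qed.

Lemma cos2_sn2 l p : cos (l * p) ^+ 2 + l ^+ 2 * sn l p ^+ 2 = 1.
Proof. by rewrite -exprMn -sin_sn cos2Dsin2. Qed.

Lemma snB l p r : sn l (p - r) = sn l p * cos (l * r) - cos (l * p) * sn l r.
Proof.
rewrite /sn; case: eqVneq => [->|l0]; first by rewrite !mul0r cos0 mulr1 mul1r.
by rewrite mulrBr sinB; field.
Qed.

Lemma sn_gt0 l p : `|l| < pi -> 0 < p -> p <= 1 -> 0 < sn l p.
Proof.
move=> lpi p0 p1; rewrite /sn; case: eqVneq => // l0.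
have aux (z : R) : 0 < z -> z < pi -> 0 < sin (z * p) / z.
  move=> z0 zpi; rewrite divr_gt0 // sin_gt0_pi // mulr_gt0 //=.
  by apply: le_lt_trans zpi; rewrite ler_piMr // ltW.
have [lneg|lpos|/esym/eqP] := ltgtP l 0; last by rewrite eq_sym (negbTE l0).
  rewrite -[sin _ / l](mulrNN) -invrN -sinN -mulNr; apply: aux; first by rewrite oppr_gt0.
  by rewrite -(ltr0_norm lneg).
by apply: aux => //; rewrite -(gtr0_norm lpos).
Qed.

Lemma zcotz_ctg l : zcotz l = ctg l 1.
Proof.
rewrite /zcotz /ctg /sn mulr1; case: eqVneq => [->|l0]; first by rewrite cos0 divr1.
by rewrite invf_div mulrCA mulrA.
Qed.

(** The difference of the two values is sn l (r - p) / (sn l p sn l r), by the subtraction formula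
    [snB]. *)
Lemma ctg_nonincreasing l p r : `|l| < pi -> 0 < p -> p <= r -> r <= 1 ->
  ctg l r <= ctg l p.
Proof.
move=> lpi p0 pr r1; have r0 := lt_le_trans p0 pr.
have sp := sn_gt0 lpi p0 (le_trans pr r1); have sr := sn_gt0 lpi r0 r1.
rewrite /ctg ler_pdivrMr // mulrAC ler_pdivlMr // -subr_ge0.
rewrite (_ : _ - _ = sn l (r - p)); last by rewrite snB; ring.
have [->|rp] := eqVneq r p; first by rewrite subrr /sn mulr0 sin0 mul0r if_same.
by apply: ltW; apply: sn_gt0 => //; rewrite ?subr_gt0 ?lt_neqAle 1?eq_sym ?rp //; lra.
Qed.

Global Instance is_derive_sn l p : is_derive p 1 (sn l) (cos (l * p)).
Proof.
rewrite /sn; case: eqVneq => [->|l0].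
  by rewrite mul0r cos0; exact: is_derive_id.
rewrite (_ : (fun r : R => _) = (fun r : R => l^-1 *: sin (l *: r))); last first.
  by apply/funext => r; rewrite /= mulrC.
apply: is_derive_eq.
by rewrite /GRing.scale /=; field.
Qed.

Lemma is_derive_cosl l p : is_derive p 1 (fun r : R => cos (l * r)) (- (l * sin (l * p))).
Proof.
rewrite (_ : (fun r : R => _) = (fun r : R => cos (l *: r))) //.
apply: is_derive_eq.
by rewrite /GRing.scale /=; ring.
Qed.

(** With [is_derive_ctg] this is the Riccati equation c' = - (c ^ 2 + l ^ 2), the Hamilton-Jacobi
    equation of a single mode. *)
Lemma ctg2 l p : sn l p != 0 -> ctg l p ^+ 2 + l ^+ 2 = (sn l p ^+ 2)^-1.
Proof.
move=> s0; apply: (mulIf (expf_neq0 2 s0)); rewrite mulVf ?expf_neq0 //.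
by rewrite mulrDl /ctg -(cos2_sn2 l p) expr_div_n divfK // expf_neq0.
Qed.

Lemma is_deriveD1 (f g : R -> R) (p a b : R) : is_derive p 1 f a ->
  is_derive p 1 g b -> is_derive p 1 (fun r => f r + g r) (a + b).
Proof. exact: is_deriveD. Qed.

Lemma is_deriveM1 (f g : R -> R) (p a b : R) : is_derive p 1 f a ->
  is_derive p 1 g b -> is_derive p 1 (fun r => f r * g r) (f p * b + g p * a).
Proof. exact: is_deriveM. Qed.

Lemma is_deriveZ1 (f : R -> R) (c p a : R) : is_derive p 1 f a ->
  is_derive p 1 (fun r => c * f r) (c * a).
Proof. exact: is_deriveZ. Qed.

Lemma is_derive_sum1 n (f : 'I_n -> R -> R) (p : R) (a : 'I_n -> R) :
  (forall i, is_derive p 1 (f i) (a i)) ->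
  is_derive p 1 (fun r => \sum_(i < n) f i r) (\sum_(i < n) a i).
Proof.
move=> fa; rewrite (_ : (fun r => _) = \sum_(i < n) f i); first exact: is_derive_sum.
by apply/funext => r; rewrite fct_sumE.
Qed.

Lemma is_derive_ctg l p : sn l p != 0 ->
  is_derive p 1 (ctg l) (- (sn l p ^+ 2)^-1).
Proof.
move=> s0.
have dv : is_derive p 1 (fun r : R => (sn l r)^-1) (- sn l p ^- 2 * cos (l * p)).
  exact: is_deriveV.
apply: is_derive_eq (is_deriveM1 (is_derive_cosl l p) dv) _.
transitivity (- (cos (l * p) ^+ 2 + l ^+ 2 * sn l p ^+ 2) / sn l p ^+ 2); last first.
  by rewrite cos2_sn2 mulN1r.
by rewrite sin_sn; field.
Qed.

(** Splitting the increment at s gives at least (a - eta) (v - s) + (a - eta) (s - u), using the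
    derivative at the single point s. *)
Lemma is_derive_straddle (f : R -> R) (s a eta : R) : is_derive s 1 f a -> 0 <= a -> 0 < eta ->
  exists2 d : R, 0 < d & forall u v : R, u <= s -> s <= v -> s - d < u -> v < s + d ->
    - (eta * (v - u)) <= f v - f u.
Proof.
move=> [df dfa] a0 eta0.
have : h^-1 *: ((f \o shift s) (h *: 1) - f s) @[h --> 0^'] --> a by rewrite -dfa.
move=> /cvgrPdist_lt/(_ _ eta0); rewrite near_withinE => /nbhs_ballP[d /= d0 dP].
exists d => // u v us sv du dv.
have key h : `|h| < d -> `|f (h + s) - f s - a * h| <= eta * `|h|.
  move=> hd; have [->|h0] := eqVneq h 0.
    by rewrite add0r mulr0 normr0 mulr0 subrr subr0 normr0.
  have := dP h; rewrite /ball /= sub0r normrN => /(_ hd h0).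
  rewrite /GRing.scale /= mulr1 => /ltW H.
  have -> : f (h + s) - f s - a * h = - (a - h^-1 * (f (h + s) - f s)) * h by field.
  by rewrite normrM normrN ler_wpM2r.
have := key (v - s); rewrite subrK ger0_norm ?subr_ge0 // ltrBlDl => /(_ dv).
rewrite ler_norml => /andP[V1 _].
have := key (u - s); rewrite subrK ler0_norm ?subr_le0 // opprB.
have du' : s - u < d by lra.
move=> /(_ du').
rewrite ler_norml => /andP[_ V2].
have : 0 <= a * (v - s) by rewrite mulr_ge0 ?subr_ge0.
have : 0 <= a * (s - u) by rewrite mulr_ge0 ?subr_ge0.
lra.
Qed.

End Trigonometry.

(** * The calibration inequality along a horizontal curve *)

Section Calibration.
Variables (R : realType).
Local Notation mu := (@lebesgue_measure R).

Lemma entry_le_norm n (z : 'rV[R]_n) i : `|z 0 i| <= `|z|.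
Proof.
rewrite [leRHS](mx_normrE z).
exact: (@le_bigmax _ _ _ 0 (fun ij : 'I_1 * 'I_n => `|z ij.1 ij.2|) (0, i)).
Qed.

Lemma norm_le_entry n (z : 'rV[R]_n) c : 0 <= c -> (forall i, `|z 0 i| <= c) -> `|z| <= c.
Proof.
move=> c0 zc; rewrite [leLHS](mx_normrE z); apply: bigmax_le => // -[i j] _ /=.
by rewrite ord1.
Qed.

Lemma dotrBr n (a u v : 'rV[R]_n) : dotr a (u - v) = dotr a u - dotr a v.
Proof. by rewrite /dotr -sumrB; apply: eq_bigr => i _; rewrite !mxE mulrBr. Qed.

Lemma dotrZr n (a u : 'rV[R]_n) c : dotr a (c *: u) = c * dotr a u.
Proof. by rewrite /dotr mulr_sumr; apply: eq_bigr => i _; rewrite !mxE mulrCA. Qed.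

Lemma dotr0 n (a : 'rV[R]_n) : dotr a 0 = 0.
Proof. by rewrite /dotr big1 // => i _; rewrite mxE mulr0. Qed.

Lemma dotr_le n (a z : 'rV[R]_n) : `|dotr a z| <= (\sum_i `|a 0 i|) * `|z|.
Proof.
rewrite /dotr mulr_suml; apply: le_trans (ler_norm_sum _ _ _) _.
by apply: ler_sum => i _; rewrite normrM ler_wpM2l // entry_le_norm.
Qed.

Lemma is_derive_dotr n (a : 'rV[R]_n) (x : R -> 'rV[R]_n) s : derivable x s 1 ->
  is_derive s 1 (fun u => dotr a (x u)) (dotr a ('D_1 x s)).
Proof.
move=> dx; apply: is_derive_sum1 => i; apply: is_deriveZ1.
rewrite derive_mx // mxE; apply: DeriveDef => //.
by move/derivable_mxP : dx => /(_ 0 i).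
Qed.

Lemma enorm_sqr n (v : 'rV[R]_n) : enorm v ^+ 2 = dotr v v.
Proof.
rewrite /enorm sqr_sqrtr; last by apply: sumr_ge0 => i _; exact: sqr_ge0.
by apply: eq_bigr => i _; rewrite expr2.
Qed.

Lemma abs_cont_dist (V : normedModType R) (x : R -> V) : abs_cont x 0 1 ->
  forall e : R, 0 < e -> exists2 d : R, 0 < d & forall u v : R,
    0 <= u -> u <= v -> v <= 1 -> v - u < d -> `|x v - x u| < e.
Proof.
move=> acx e e0; have [d d0 H] := acx e e0; exists d => // u v u0 uv v1 vud.
have := H 1%N (fun=> u) (fun=> v) (fun=> conj u0 (conj uv v1)).
by rewrite !big_ord1; apply=> // k k'; rewrite !ord1.
Qed.

Lemma abs_cont_bounded (V : normedModType R) (x : R -> V) : abs_cont x 0 1 ->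
  exists2 B : R, 0 <= B & forall u : R, 0 <= u -> u <= 1 -> `|x u| <= B.
Proof.
move=> /abs_cont_dist/(_ 1 ltr01) [d d0 H].
pose Q (a b : R) := exists2 B : R, 0 <= B & forall u : R, a <= u -> u <= b -> `|x u| <= B.
have : Q 0 1; last by [].
apply: cousin => [a b c a0 ab bc c1 [B B0 HB] [B' B'0 HB']|s s0 s1].
  exists (B + B'); first exact: addr_ge0.
  move=> u au uc; have [ub|/ltW bu] := leP u b.
    by apply: le_trans (HB _ au ub) _; rewrite lerDl.
  by apply: le_trans (HB' _ bu uc) _; rewrite lerDr.
exists d => // u v u0 us sv v1 du dv; exists (`|x s| + 1); first by rewrite addr_ge0.
move=> r ur rv; rewrite -lerBlDl; apply: le_trans (lerB_dist _ _) _.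
have [rs|/ltW sr] := leP r s.
  by rewrite distrC; apply: ltW; apply: H => //; [exact: le_trans ur | lra].
by apply: ltW; apply: H => //; [exact: le_trans rv v1 | lra].
Qed.

Variables (q m : nat) (U : 'I_m -> 'M[R]_q).

(* Completing the square in each spectral plane, with [r] the inverse of the
   speed of the reparametrization. *)
Lemma mode_ge0 (l p r a b a' b' : R) : sn l p != 0 -> 0 < r ->
  0 <= r * (a' ^+ 2 + b' ^+ 2) + r^-1 * (sn l p ^+ 2)^-1 * (a ^+ 2 + b ^+ 2)
     - 2 * ctg l p * (a * a' + b * b') - 2 * (l * (b * a' - a * b')).
Proof.
move=> s0 r0; rewrite -(ctg2 s0); set C := ctg l p.
rewrite (_ : _ - _ = r^-1 * ((r * a' - C * a - l * b) ^+ 2 + (r * b' - C * b + l * a) ^+ 2)).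
  apply: mulr_ge0; last by rewrite addr_ge0 ?sqr_ge0.
  by rewrite invr_ge0 ltW.
by field; rewrite gt_eqF.
Qed.

Lemma norm_between (a b c : R) : b <= c -> c <= a -> `|c| <= `|a| + `|b|.
Proof.
move=> bc ca; have := ler_norm a; have := ler_norm (- b); rewrite normrN.
have := normr_ge0 a; have := normr_ge0 b.
by rewrite ler_norml => *; apply/andP; split; lra.
Qed.

(** [w] stands for arc length. The condition [0 < w 0] keeps the time [w s / M] away from the pole
    of [ctg], and [w 1 <= M] keeps it in the range where [ctg] is monotone. *)
Lemma calibration tau lam al be (x : R -> 'rV[R]_q) (t : R -> 'rV[R]_m) g
    (w w' : R -> R) (M : R) (N : set R) :
  is_frame U tau lam al be -> (forall k, `|lam k| < pi) ->
  abs_cont x 0 1 -> abs_cont t 0 1 -> x 0 = 0 -> t 0 = 0 -> x 1 = g.1 -> t 1 = g.2 ->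
  mu.-negligible N ->
  (forall u v : R, 0 <= u -> u <= v -> v <= 1 -> w u <= w v) -> 0 < w 0 -> w 1 <= M ->
  (forall s : R, 0 <= s -> s <= 1 -> ~ N s ->
     [/\ derivable x s 1, derivable t s 1,
         'D_1 t s = 2^-1 *: brk U (x s) ('D_1 x s), is_derive s 1 w (w' s) &
         0 < w' s /\ enorm ('D_1 x s) <= w' s]) ->
  phi U g tau <= M ^+ 2.
Proof.
move=> fr lpi acx act x0 t0 x1 t1 negN wmono w0 w1 good.
have M0 : 0 < M by apply: lt_le_trans w0 (le_trans _ w1); apply: wmono.
have pP (s : R) : 0 <= s -> s <= 1 -> 0 < w s / M /\ w s / M <= 1.
  move=> s0 s1; split.
    by rewrite divr_gt0 //; apply: lt_le_trans w0 _; apply: wmono.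
  by rewrite ler_pdivrMr // mul1r; apply: le_trans w1; apply: wmono.
pose y2 k s := dotr (al k) (x s) ^+ 2 + dotr (be k) (x s) ^+ 2.
(* [F] is a calibration: [w / M] is a time in [0, 1] in which the curve has speed
   at most [M], and the last two terms are the Hamilton-Jacobi value function. *)
pose F s := M * w s - 4 * dotr tau (t s) - \sum_k ctg (lam k) (w s / M) * y2 k s.
have F01 : F 0 <= F 1.
  have [B B0 xB] := abs_cont_bounded acx.
  pose nA k := \sum_i `|al k 0 i|; pose nB k := \sum_i `|be k 0 i|.
  pose Ck k := `|ctg (lam k) (w 0 / M)| + `|ctg (lam k) 1|.
  (* The first term bounds the variation of tau . t. In the second, [Ck k] bounds [ctg], whose
     values lie between those at times [w 0 / M] and 1, and the remaining factor is a Lipschitz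
     constant of the squared coordinates where the norm is at most [B]. *)
  pose K := 4 * (\sum_i `|tau 0 i|) + \sum_k Ck k * (2 * B * (nA k ^+ 2 + nB k ^+ 2)).
  have K1 : 0 <= 4 * (\sum_i `|tau 0 i|) by rewrite mulr_ge0 // sumr_ge0.
  have K2 : 0 <= \sum_k Ck k * (2 * B * (nA k ^+ 2 + nB k ^+ 2)).
    by apply: sumr_ge0 => k _; rewrite !mulr_ge0 ?addr_ge0 ?sqr_ge0.
  apply: (abs_cont_nondecreasing (N := N) (K := K) acx act) => //; first exact: addr_ge0.
    move=> u v u0 uv v1.
    have u1 := le_trans uv v1; have v0 := le_trans u0 uv.
    have E1 : 0 <= M * w v - M * w u by rewrite -mulrBr mulr_ge0 ?subr_ge0 ?wmono // ltW.
    have E2 : `|dotr tau (t v) - dotr tau (t u)| <= (\sum_i `|tau 0 i|) * `|t v - t u|.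
      by rewrite -dotrBr dotr_le.
    have sq (a : 'rV[R]_q) : `|dotr a (x v) ^+ 2 - dotr a (x u) ^+ 2| <=
        2 * B * (\sum_i `|a 0 i|) ^+ 2 * `|x v - x u|.
      rewrite subr_sqr normrM -dotrBr.
      have H1 := dotr_le a (x v - x u).
      have H2 : `|dotr a (x v) + dotr a (x u)| <= (\sum_i `|a 0 i|) * (2 * B).
        apply: le_trans (ler_normD _ _) _.
        have Bv : `|dotr a (x v)| <= (\sum_i `|a 0 i|) * B.
          by apply: le_trans (dotr_le _ _) _; rewrite ler_wpM2l ?sumr_ge0 // xB.
        have Bu : `|dotr a (x u)| <= (\sum_i `|a 0 i|) * B.
          by apply: le_trans (dotr_le _ _) _; rewrite ler_wpM2l ?sumr_ge0 // xB.
        lra.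
      apply: le_trans (ler_pM _ _ H1 H2) _ => //.
      by rewrite le_eqVlt; apply/orP; left; apply/eqP; ring.
    (* As [ctg] decreases along the curve, replacing its value at v by the one at u can only
       increase the left side; only increments of [y2 k] remain, and no modulus of continuity of [w]
       is needed. *)
    have E3 : \sum_k ctg (lam k) (w v / M) * y2 k v - \sum_k ctg (lam k) (w u / M) * y2 k u
       <= (\sum_k Ck k * (2 * B * (nA k ^+ 2 + nB k ^+ 2))) * `|x v - x u|.
      rewrite -sumrB mulr_suml; apply: ler_sum => k _.
      have [pu0 pu1] := pP u u0 u1; have [pv0 pv1] := pP v v0 v1.
      have [p00 p01] := pP 0 (lexx _) ler01.
      have wuv : w u / M <= w v / M by rewrite ler_pM2r ?invr_gt0 // wmono.
      have w0u : w 0 / M <= w u / M by rewrite ler_pM2r ?invr_gt0 // wmono.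
      have y0 : 0 <= y2 k v by rewrite addr_ge0 ?sqr_ge0.
      have c1 := ctg_nonincreasing (lpi k) pu0 wuv pv1.
      have c2 := ctg_nonincreasing (lpi k) p00 w0u pu1.
      have c3 := ctg_nonincreasing (lpi k) pu0 pu1 (lexx 1).
      have Cu : `|ctg (lam k) (w u / M)| <= Ck k.
        by rewrite /Ck; exact: norm_between.
      have s1 : ctg (lam k) (w v / M) * y2 k v <= ctg (lam k) (w u / M) * y2 k v by rewrite ler_wpM2r.
      apply: (@le_trans _ _ (ctg (lam k) (w u / M) * (y2 k v - y2 k u))).
        by rewrite mulrBr lerD2r.
      apply: le_trans (ler_norm _) _; rewrite normrM -mulrA; apply: ler_pM => //.
      rewrite /y2 (_ : _ - _ = (dotr (al k) (x v) ^+ 2 - dotr (al k) (x u) ^+ 2)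
        + (dotr (be k) (x v) ^+ 2 - dotr (be k) (x u) ^+ 2)); last by ring.
      apply: le_trans (ler_normD _ _) _; rewrite mulrDr mulrDl.
      exact: lerD (sq (al k)) (sq (be k)).
    rewrite /F; move: E2; rewrite ler_norml => /andP[_ E2].
    rewrite /K mulrDl !mulrDr.
    have G1 : 0 <= (\sum_k Ck k * (2 * B * (nA k ^+ 2 + nB k ^+ 2))) * `|t v - t u| by rewrite mulr_ge0.
    have G2 : 0 <= 4 * (\sum_i `|tau 0 i|) * `|x v - x u| by rewrite mulr_ge0.
    lra.
  move=> s s0 s1 Ns eta eta0.
  have [dx dt tE dw [w'0 xw']] := good s s0 s1 Ns.
  have [p0 p1] := pP s s0 s1.
  have snp k : sn (lam k) (w s / M) != 0 by rewrite gt_eqF // sn_gt0.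
  set v := 'D_1 x s in tE xw'.
  pose yd k := 2 * (dotr (al k) (x s) * dotr (al k) v + dotr (be k) (x s) * dotr (be k) v).
  pose F' := M * w' s - 4 * dotr tau ('D_1 t s)
     - \sum_k (ctg (lam k) (w s / M) * yd k
             + y2 k s * (- (sn (lam k) (w s / M) ^+ 2)^-1 * (M^-1 * w' s))).
  have dF : is_derive s 1 F F'.
    have -> : F = fun s => (M * w s + -4 * dotr tau (t s)) +
        -1 * \sum_k ctg (lam k) (M^-1 * w s) * y2 k s.
      apply/funext => r; rewrite /F mulN1r mulNr; congr (_ - _).
      by apply: eq_bigr => k _; rewrite [M^-1 * _]mulrC.
    have dC k : is_derive s 1 (fun r => ctg (lam k) (M^-1 * w r))
        (- (sn (lam k) (w s / M) ^+ 2)^-1 * (M^-1 * w' s)).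
      have dc : is_derive (M^-1 * w s) 1 (ctg (lam k)) (- (sn (lam k) (w s / M) ^+ 2)^-1).
        by rewrite [M^-1 * _]mulrC; exact: is_derive_ctg.
      exact: (is_derive1_comp (g := fun r => M^-1 * w r) dc (is_deriveZ1 M^-1 dw)).
    have dy k : is_derive s 1 (y2 k) (yd k).
      have da := is_derive_dotr (al k) dx; have db := is_derive_dotr (be k) dx.
      apply: is_derive_eq (is_deriveD1 (is_deriveM1 da da) (is_deriveM1 db db)) _.
      by rewrite /yd; ring.
    apply: is_derive_eq (is_deriveD1 (is_deriveD1 (is_deriveZ1 M dw)
      (is_deriveZ1 (-4) (is_derive_dotr tau dt)))
      (is_deriveZ1 (-1) (is_derive_sum1 (fun k => is_deriveM1 (dC k) (dy k))))) _.
    rewrite /F' mulN1r mulNr; congr (_ - _).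
    by apply: eq_bigr => k _; rewrite [M^-1 * w s]mulrC.
  (* Put r = M / w' s. By [speed], M w' s is at least the sum of r |v_k| ^ 2 over the modes, which
     leaves in each mode the expression of [mode_ge0]. *)
  have F'0 : 0 <= F'.
    rewrite /F'; have -> : 4 * dotr tau ('D_1 t s) = \sum_k 2 * (lam k *
        (dotr (be k) (x s) * dotr (al k) v - dotr (al k) (x s) * dotr (be k) v)).
      by rewrite tE dotrZr (frame_brk fr) -mulr_sumr; field.
    have speed : \sum_k (M / w' s) * (dotr (al k) v ^+ 2 + dotr (be k) v ^+ 2) <= M * w' s.
      rewrite -mulr_sumr (_ : \sum_k _ = enorm v ^+ 2); last first.
        by rewrite enorm_sqr (frame_dotr fr); apply: eq_bigr => k _; rewrite !expr2.
      rewrite -mulrA ler_pM2l // ler_pdivrMl // -expr2 lerXn2r // nnegrE ?(ltW w'0) //.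
      exact: sqrtr_ge0.
    rewrite -addrA -opprD -big_split /= subr_ge0; apply: le_trans speed.
    apply: ler_sum => k _; rewrite -subr_ge0.
    have r0 : 0 < M / w' s by rewrite divr_gt0.
    have := mode_ge0 (dotr (al k) (x s)) (dotr (be k) (x s)) (dotr (al k) v) (dotr (be k) v) (snp k) r0.
    rewrite invf_div /y2 /yd.
    set X := _ - _ - _; set Y := _ - (_ + _); suff -> : X = Y by [].
    by rewrite /X /Y; ring.
  have [d d0 Hd] := is_derive_straddle dF F'0 eta0.
  by exists d => // u r u0 us sr r1 du dr; exact: Hd.
have F0 : 0 <= F 0.
  rewrite /F t0 dotr0 mulr0 subr0 big1 ?subr0 ?mulr_ge0 1?ltW // => k _.
  by rewrite /y2 x0 !dotr0 expr0n /= addr0 mulr0.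
have F1 : F 1 <= M ^+ 2 - phi U g tau.
  rewrite (frame_phi fr) /F t1 -x1.
  have H1 : M * w 1 <= M ^+ 2 by rewrite expr2 ler_pM2l.
  have H2 : \sum_k zcotz (lam k) * y2 k 1 <= \sum_k ctg (lam k) (w 1 / M) * y2 k 1.
    apply: ler_sum => k _; rewrite ler_wpM2r ?addr_ge0 ?sqr_ge0 // zcotz_ctg.
    by have [p0 p1] := pP 1 ler01 (lexx _); exact: ctg_nonincreasing.
  by rewrite /y2 in H2 *; lra.
by rewrite -subr_ge0; apply: le_trans F1; exact: le_trans F01.
Qed.

End Calibration.

(** * A strictly increasing substitute for arc length *)

Section ArcLength.
Variables (R : realType) (q : nat).
Local Notation mu := (@lebesgue_measure R).

(** No measurability is assumed, since the integral of a nonnegative function is a supremum over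
    simple functions below it. The speed of a curve is shown measurable only off the exceptional
    null set. *)
Lemma ge0_le_integral_subset (D E : set R) (f : R -> R) : (forall s, 0 <= f s) ->
  D `<=` E -> (\int[mu]_(s in D) (f s)%:E <= \int[mu]_(s in E) (f s)%:E)%E.
Proof.
move=> f0 DE; rewrite !ge0_integralE; try by move=> s _; rewrite lee_fin.
apply: le_ereal_sup => _ /= [h hf <-]; exists h => // s; apply: le_trans (hf s) _.
rewrite !patchE; case: ifPn => [/set_mem/DE sE|_]; first by rewrite mem_set.
by case: ifPn => // _; rewrite lee_fin.
Qed.

(** A curve is controlled on [0, 1] only; composed with this projection its coordinates are
    continuous on the whole line. *)
Definition clamp (s : R) : R := Num.max 0 (Num.min 1 s).

Lemma clamp_itv s : 0 <= clamp s /\ clamp s <= 1.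
Proof. by rewrite /clamp le_max lexx ge_max ler01 ge_min lexx. Qed.

Lemma clamp_id s : 0 <= s -> s <= 1 -> clamp s = s.
Proof. by move=> s0 s1; rewrite /clamp (min_idPr s1) (max_idPr s0). Qed.

Lemma clamp_lip s r : s <= r -> 0 <= clamp r - clamp s <= r - s.
Proof.
have E z : [\/ z <= 0 /\ clamp z = 0, 1 <= z /\ clamp z = 1 | [/\ 0 <= z, z <= 1 & clamp z = z]].
  have [z0|/ltW z0] := leP z 0.
    by apply: Or31; split => //; rewrite /clamp (min_idPr _) ?(max_idPl _) // (le_trans z0).
  have [z1|/ltW z1] := leP z 1; first by apply: Or33; split => //; exact: clamp_id.
  by apply: Or32; split => //; rewrite /clamp (min_idPl _) ?(max_idPr _).
move=> sr; case: (E s) => [[? ->]|[? ->]|[? ? ->]]; case: (E r) => [[? ->]|[? ->]|[? ? ->]];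
  by apply/andP; split; lra.
Qed.

Lemma continuous_clamp (x : R -> 'rV[R]_q) a : abs_cont x 0 1 ->
  continuous (fun s => x (clamp s) 0 a : R).
Proof.
move=> /abs_cont_dist acx s; apply/cvgrPdist_lt => e e0.
have [d d0 H] := acx e e0.
near=> r.
have rs : `|s - r| < d by near: r; apply: cvgr_dist_lt.
have Hx u v : u <= v -> v - u < d -> `|x (clamp v) - x (clamp u)| < e.
  move=> uv vud; have /andP[c1 c2] := clamp_lip uv.
  apply: H; [by case: (clamp_itv u)| by rewrite -subr_ge0 |by case: (clamp_itv v)|].
  exact: le_lt_trans vud.
have key u v : u <= v -> v - u < d -> `|x (clamp v) 0 a - x (clamp u) 0 a| < e.
  move=> uv vud; apply: le_lt_trans (Hx u v uv vud).
  by have := entry_le_norm (x (clamp v) - x (clamp u)) a; rewrite !mxE.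
have [sr|/ltW sr] := leP r s.
  by apply: key => //; rewrite -(ger0_norm (_ : 0 <= s - r)) ?subr_ge0.
rewrite distrC; apply: key => //.
by rewrite -(ger0_norm (_ : 0 <= r - s)) ?subr_ge0 // distrC.
Unshelve. all: by end_near. Qed.

(** The derivative is the pointwise limit of the difference quotients with steps 1 / (n + 1) of the
    clamped coordinate. At interior points these eventually agree with those of x. *)
Lemma measurable_derive_coord (x : R -> 'rV[R]_q) (D : set R) a : measurable D ->
  abs_cont x 0 1 -> (forall s, D s -> [/\ 0 < s, s < 1 & derivable x s 1]) ->
  measurable_fun D (fun s => 'D_1 x s 0 a : R).
Proof.
move=> mD acx HD; pose f : R -> R := fun s => x (clamp s) 0 a.
have cf : continuous f by exact: continuous_clamp.
have mf : measurable_fun (setT : set R) f by exact: continuous_measurable_fun.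
pose h n s := n.+1%:R * (f (s + n.+1%:R^-1) - f s).
apply: (@measurable_fun_cvg _ _ _ D h) => [n|s Ds].
  apply: (@measurable_funS _ _ _ _ setT) => //.
  apply: measurable_funM; first exact: measurable_cst.
  apply: measurable_funB => //; apply: measurableT_comp => //.
  by apply: measurable_funD; [exact: measurable_id | exact: measurable_cst].
have [s0 s1 dx] := HD s Ds.
have /derivable_mxP/(_ 0 a) da := dx.
rewrite derive_mx // mxE; move: da; set g := (fun t => x t 0 a) => da.
have : t^-1 *: ((g \o shift s) (t *: 1) - g s) @[t --> 0^'] --> 'D_1 g s by exact: da.
move=> /cvgrPdist_lt H; apply/cvgrPdist_lt => e e0.
have := H e e0; rewrite near_withinE => /nbhs_ballP[d /= d0 dP].
have s1' : 0 < 1 - s by rewrite subr_gt0.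
near=> n.
have n0 : (0 : R) < n.+1%:R^-1 by rewrite invr_gt0.
have nd : (n.+1%:R^-1 : R) < d by near: n; exact: near_infty_natSinv_lt (PosNum d0).
have n1 : (n.+1%:R^-1 : R) < 1 - s.
  by near: n; exact: near_infty_natSinv_lt (PosNum s1').
have := dP n.+1%:R^-1; rewrite /ball /= sub0r normrN gtr0_norm // => /(_ nd).
rewrite gt_eqF // => /(_ isT).
have E1 : clamp (s + n.+1%:R^-1) = s + n.+1%:R^-1.
  by apply: clamp_id; [rewrite addr_ge0 // ltW | rewrite -lerBrDl ltW].
have E2 : clamp s = s by apply: clamp_id; exact: ltW.
by rewrite /h /f /g /= E1 E2 invrK /GRing.scale /= mulr1 (addrC _ s).
Unshelve. all: by end_near. Qed.

Lemma arclength (x : R -> 'rV[R]_q) (L eps : R) : abs_cont x 0 1 ->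
  {ae mu, forall s, s \in `[0, 1] -> derivable x s 1} ->
  curve_length x = L%:E -> 0 < eps ->
  exists w w' : R -> R, exists N : set R, [/\ mu.-negligible N,
    forall u v : R, 0 <= u -> u <= v -> v <= 1 -> w u <= w v, 0 < w 0,
    w 1 <= L + 2 * eps &
    forall s : R, 0 <= s -> s <= 1 -> ~ N s ->
      is_derive s 1 w (w' s) /\ 0 < w' s /\ enorm ('D_1 x s) <= w' s].
Proof.
move=> acx [B [mB B0 HB]] Lx eps0.
pose D : set R := [set` `]0, 1[] `\` B.
have mD : measurable D by apply: measurableD => //; exact: measurable_itv.
have HD s : D s -> [/\ 0 < s, s < 1 & derivable x s 1].
  move=> [/=]; rewrite in_itv /= => /andP[s0 s1] nB; split => //.
  have [//|nd] := pselect (derivable x s 1); exfalso; apply: nB; apply: HB => /= H.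
  by apply: nd; apply: H; rewrite in_itv /= !ltW.
pose f s := enorm ('D_1 x s).
have f0 s : 0 <= f s by exact: sqrtr_ge0.
have mf : measurable_fun D f.
  have ms : measurable_fun (setT : set R) (@Num.sqrt R).
    by apply: continuous_measurable_fun; exact: sqrt_continuous.
  have mq : measurable_fun D (fun s => \sum_a 'D_1 x s 0 a ^+ 2 : R).
    apply: measurable_sum => a; apply: measurable_funX.
    exact: measurable_derive_coord.
  exact: (measurableT_comp ms mq).
pose g : R -> R := f \_ D.
have g0 s : 0 <= g s by rewrite /g patchE; case: ifP.
have mg : measurable_fun setT g by apply/(measurable_restrictT _ mD).
have gE : EFin \o g = (EFin \o f) \_ D.
  by apply/funext => s; rewrite /= /g !patchE; case: ifP.
have Dint : (\int[mu]_s (g s)%:E <= L%:E)%E.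
  rewrite -Lx /curve_length (_ : (fun s => _) = EFin \o g) // gE -integral_mkcond.
  apply: ge0_le_integral_subset => // s [/=]; rewrite !in_itv /= => /andP[s0 s1] _.
  by rewrite !ltW.
have gint : mu.-integrable setT (EFin \o g).
  apply/integrableP; split; first exact/measurable_EFinP.
  rewrite (_ : (fun s => _) = (fun s => (g s)%:E)); first exact: le_lt_trans Dint (ltry L).
  by apply/funext => s /=; rewrite ger0_norm.
have gintS (A : set R) : measurable A -> mu.-integrable A (EFin \o g).
  by move=> mA; apply: integrableS gint.
pose G (s : R) : R := (\int[mu]_(r in [set` `[0, s]]) g r)%R.
have Gmono u v : u <= v -> G u <= G v.
  move=> uv; rewrite /G /Rintegral; apply: fine_le.
  - by apply: integrable_fin_num; [exact: measurable_itv | exact: (gintS _ (measurable_itv _))].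
  - by apply: integrable_fin_num; [exact: measurable_itv | exact: (gintS _ (measurable_itv _))].
  - apply: ge0_le_integral_subset => // s; rewrite /= !in_itv /= => /andP[-> su].
    exact: le_trans uv.
have G0 s : 0 <= G s by apply: Rintegral_ge0.
have G1 : G 1 <= L.
  rewrite -lee_fin /G /Rintegral fineK.
    apply: le_trans Dint; exact: ge0_le_integral_subset.
  by apply: integrable_fin_num; [exact: measurable_itv | exact: (gintS _ (measurable_itv _))].
have locg : locally_integrable setT g by apply: open_integrable_locally => //; exact: openT.
have gint0 y : mu.-integrable [set` Interval (BLeft 0) (BRight y)] (EFin \o g).
  exact: (gintS _ (measurable_itv _)).
have [B2 [mB2 B20 HB2]] := FTC1 gint0 locg.
have negB : mu.-negligible B by exists B; split.
have negB2 : mu.-negligible B2 by exists B2; split.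
have neg1 (c : R) : mu.-negligible [set c].
  by exists [set c]; split => //; rewrite ?lebesgue_measure_set1.
(* The constant [eps] makes [w 0] positive, the term [eps * s] makes the derivative positive where
   the curve stands still, and together they account for the excess [2 * eps] over L. The derivative
   of [G] is Lebesgue differentiation. *)
exists (fun s => eps + (eps * s + G s)), (fun s => eps + g s), (B `|` B2 `|` ([set 0] `|` [set 1])); split.
- apply: negligibleU; last by apply: negligibleU; exact: neg1.
  by apply: negligibleU.
- by move=> u v u0 uv v1; rewrite lerD2l lerD // ?Gmono // ler_pM2l.
- by rewrite mulr0 add0r ltr_wpDr.
- by rewrite mulr1; lra.
- move=> s s0 s1 nN.
  have s0' : 0 < s by rewrite lt_neqAle s0 andbT; apply/eqP => E; apply: nN; right; left.
  have s1' : s < 1 by rewrite lt_neqAle s1 andbT; apply/eqP => E; apply: nN; right; right.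
  have Ds : D s by split; [rewrite /= in_itv /= s0' | move=> Bs; apply: nN; left; left].
  have gs : g s = f s by rewrite /g patchE mem_set.
  split; last by rewrite gs -/(f s); have := f0 s; split; lra.
  have [dG GE] : derivable G s 1 /\ derive1 G s = g s.
    have [//|nd] := pselect (derivable G s 1 /\ derive1 G s = g s).
    exfalso; apply: nN; left; right; apply: HB2 => /= H; apply: nd; apply: H.
    by rewrite /= ?bnd_simp ?lte_fin ?ltW.
  have DG : is_derive s 1 G (g s).
    exact: DeriveDef dG (etrans (esym (derive1E G s)) GE).
  have D1 := is_deriveD1 (is_deriveZ1 eps (is_derive_id s 1)) DG.
  have D0 := is_deriveD1 (is_derive_cst eps s 1) D1.
  by apply: is_derive_eq D0 _; rewrite add0r mulr1.
Qed.

End ArcLength.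

(** * The bound of phi by the squared length *)

Section LowerBound.
Variables (R : realType) (q m : nat) (U : 'I_m -> 'M[R]_q).

Lemma phi_le_length2 tau lam al be (x : R -> 'rV[R]_q) (t : R -> 'rV[R]_m) g L :
  is_frame U tau lam al be -> (forall k, `|lam k| < pi) ->
  horizontal_curve U x t g -> curve_length x = L%:E -> phi U g tau <= L ^+ 2.
Proof.
move=> fr lpi [[acx act] [x0 t0] [x1 t1] [B [mB B0 HB]]] Lx.
have L0 : 0 <= L.
  by rewrite -lee_fin -Lx; apply: integral_ge0 => s _; rewrite lee_fin sqrtr_ge0.
have bound eps : 0 < eps -> phi U g tau <= (L + 2 * eps) ^+ 2.
  move=> eps0.
  have aex : {ae @lebesgue_measure R, forall s, s \in `[0, 1] -> derivable x s 1}.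
    exists B; split => // s /= nd; apply: HB => /= H; apply: nd => s01.
    by have [] := H s01.
  have [w [w' [N [negN wmono w0 w1 wN]]]] := arclength acx aex Lx eps0.
  have negNB : (@lebesgue_measure R).-negligible (N `|` B).
    by apply: negligibleU => //; exists B; split.
  apply: (calibration (w' := w') fr lpi acx act x0 t0 x1 t1 negNB wmono w0 w1).
  move=> s s0 s1 nNB.
  have [dw ww'] : is_derive s 1 w (w' s) /\ 0 < w' s /\ enorm ('D_1 x s) <= w' s.
    by apply: wN => // Ns; apply: nNB; left.
  have [dx dt tE] : [/\ derivable x s 1, derivable t s 1 &
      'D_1 t s = 2^-1 *: brk U (x s) ('D_1 x s)].
    have s01 : s \in `[0, 1] by rewrite in_itv /= s0 s1.
    have [//|nd] := pselect [/\ derivable x s 1, derivable t s 1 &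
      'D_1 t s = 2^-1 *: brk U (x s) ('D_1 x s)].
    by exfalso; apply: nNB; right; apply: HB => /= H; apply: nd; exact: H.
  by split.
rewrite leNgt; apply/negP => Lphi.
set d := phi U g tau - L ^+ 2.
have d0 : 0 < d by rewrite subr_gt0.
(* For eps <= 1, (L + 2 eps) ^ 2 - L ^ 2 <= 4 eps (L + 1), which this choice makes at most d / 2. *)
pose eps := Num.min 1 (d / (8 * (L + 1))).
have eps0 : 0 < eps by rewrite lt_min ltr01 divr_gt0 // mulr_gt0 // ltr_wpDl.
have e1 : eps <= 1 by rewrite ge_min lexx.
have e2 : eps * (8 * (L + 1)) <= d.
  by rewrite -ler_pdivlMr ?mulr_gt0 ?ltr_wpDl // ge_min lexx orbT.
have := bound eps eps0; rewrite leNgt => /negP; apply.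
rewrite -subr_gt0.
have e3 : eps ^+ 2 <= eps by rewrite expr2 ler_piMr // ltW.
have : 0 <= eps * L by rewrite mulr_ge0 // ltW.
by move: e2 e3 d0; rewrite /d; lra.
Qed.

End LowerBound.

(** * The explicit curve of constant speed *)

Section Extremal.
Variables (R : realType).
Local Notation mu := (@lebesgue_measure R).

Lemma lipschitz01 (f f' : R -> R) (K u v : R) :
  (forall s : R, 0 <= s -> s <= 1 -> is_derive s 1 f (f' s) /\ `|f' s| <= K) ->
  0 <= u -> u <= v -> v <= 1 -> `|f v - f u| <= K * (v - u).
Proof.
move=> H u0 uv v1.
have [->|uv'] := eqVneq u v; first by rewrite !subrr normr0 mulr0.
have ltuv : u < v by rewrite lt_neqAle uv' uv.
have dfs c : c \in `]u, v[%R -> is_derive c 1 f (f' c).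
  rewrite in_itv /= => /andP[uc cv].
  by have [] := H c (le_trans u0 (ltW uc)) (le_trans (ltW cv) v1).
have cf : {within `[u, v], continuous f}.
  apply: derivable_within_continuous => c; rewrite in_itv /= => /andP[uc cv].
  by have [[]] := H c (le_trans u0 uc) (le_trans cv v1).
have [c cuv ->] := MVT_segment uv dfs cf.
move: cuv; rewrite in_itv /= => /andP[uc cv].
have [_ Hc] := H c (le_trans u0 uc) (le_trans cv v1).
by rewrite normrM (ger0_norm (_ : 0 <= v - u)) ?subr_ge0 // ler_wpM2r ?subr_ge0.
Qed.

Lemma C1_abs_cont n (z : R -> 'rV[R]_n) (z' : 'I_n -> R -> R) :
  (forall j, continuous (z' j)) ->
  (forall j (s : R), 0 <= s -> s <= 1 -> is_derive s 1 (fun s => z s 0 j) (z' j s)) ->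
  abs_cont z 0 1.
Proof.
move=> cz' dz.
have bd j : exists K : R, 0 <= K /\ forall s : R, 0 <= s -> s <= 1 -> `|z' j s| <= K.
  have cn : {within `[0, 1], continuous (fun s => `|z' j s|)}.
    apply: continuous_subspaceT => s.
    exact: (cvg_norm (cz' j s)).
  have [c _ Hc] := EVT_max ler01 cn.
  by exists `|z' j c|; split => // s s0 s1; apply: Hc; rewrite in_itv /= s0 s1.
have [K HK] := fin_all_exists bd.
have K0 j : 0 <= K j by case: (HK j).
pose C := \sum_j K j; have C0 : 0 <= C by apply: sumr_ge0.
have KC j : K j <= C by rewrite /C (bigD1 j) //= lerDl; apply: sumr_ge0.
have lip (u v : R) : 0 <= u -> u <= v -> v <= 1 -> `|z v - z u| <= C * (v - u).
  move=> u0 uv v1; apply: norm_le_entry => [|j]; first by rewrite mulr_ge0 ?subr_ge0.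
  rewrite !mxE; apply: (@lipschitz01 (fun s => z s 0 j) (z' j)) => // s s0 s1; split; first exact: dz.
  by apply: le_trans (KC j); case: (HK j) => _; apply.
move=> eps eps0; exists (eps / (C + 1)); first by rewrite divr_gt0 // ltr_wpDl.
move=> k l r lr _; rewrite ltr_pdivlMr ?ltr_wpDl // => sum_lt.
apply: le_lt_trans sum_lt; rewrite mulr_suml; apply: ler_sum => i _.
have [l0 [lr' r1]] := lr i; apply: le_trans (lip _ _ l0 lr' r1) _.
by rewrite mulrC ler_wpM2l ?subr_ge0 // lerDl.
Qed.

Lemma derivable_continuous (f : R -> R) : (forall s : R, derivable f s 1) -> continuous f.
Proof.
by move=> df s; apply: differentiable_continuous; exact/derivable1_diffP.
Qed.

Lemma antiderivative01 (h : R -> R) : continuous h -> exists H : R -> R,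
  H 0 = 0 /\ forall s : R, 0 <= s -> s <= 1 -> is_derive s 1 H (h s).
Proof.
(* Starting at -1 and integrating up to 2 puts [0, 1] in the interior, so the derivative is
   two-sided at 0 and 1 as well. *)
move=> ch; pose F (s : R) : R := (\int[mu]_(r in [set` `[(-1) : R, s]]) h r)%R.
have ih : mu.-integrable [set` `[(-1) : R, 2]] (EFin \o h).
  by apply: continuous_compact_integrable; [exact: segment_compact | exact: continuous_subspaceT].
exists (fun s => F s - F 0); split; first by rewrite subrr.
move=> s s0 s1.
have s2 : s < 2 by lra.
have m1 : -1 < s by lra.
have [dF FE] := continuous_FTC1_closed s2 ih m1 (ch s).
have D : is_derive s 1 F (h s) by exact: DeriveDef dF (etrans (esym (derive1E F s)) FE).
by apply: is_derive_eq (is_deriveD1 D (is_derive_cst (- F 0) s 1)) _; rewrite addr0.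
Qed.

Variables (q m : nat) (U : 'I_m -> 'M[R]_q).

(** The complex coordinates of x in the eigenbasis are multiplied by E k + i O k, and the real part
    of the resulting vector is taken, as in [frame_fun]. *)
Definition comb (al be : 'I_q -> 'rV[R]_q) (x : 'rV[R]_q) (E O : 'I_q -> R) : 'rV[R]_q :=
  \sum_k ((E k * dotr (al k) x - O k * dotr (be k) x) *: al k
        + (O k * dotr (al k) x + E k * dotr (be k) x) *: be k).

Lemma is_derive_comb al be x (E O E' O' : 'I_q -> R -> R) (s : R) j :
  (forall k, is_derive s 1 (E k) (E' k s)) -> (forall k, is_derive s 1 (O k) (O' k s)) ->
  is_derive s 1 (fun r => comb al be x (E^~ r) (O^~ r) 0 j) (comb al be x (E'^~ s) (O'^~ s) 0 j).
Proof.
move=> dE dO; rewrite /comb summxE.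
rewrite (_ : (fun r => _) = fun r => \sum_k
   ((dotr (al k) x * al k 0 j + dotr (be k) x * be k 0 j) * E k r +
    (dotr (al k) x * be k 0 j - dotr (be k) x * al k 0 j) * O k r)); last first.
  by apply/funext => r; rewrite summxE; apply: eq_bigr => k _; rewrite !mxE; ring.
apply: is_derive_eq (is_derive_sum1 (fun k => is_deriveD1 (is_deriveZ1 _ (dE k)) (is_deriveZ1 _ (dO k)))) _.
by apply: eq_bigr => k _; rewrite !mxE; ring.
Qed.

(** The curve realizes equality in [mode_ge0] with r = 1: both squares vanish when the complex
    coordinate of each mode satisfies z' = (ctg l s - i l) z. The solution that ends at the
    coordinate of x0 is explicit, and |z'| = |z 1| / sn l 1 is constant. The vertical part is then
    integrated from the horizontality equation, and T is wherever it ends. *)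
Lemma extremal theta lam al be (x0 : 'rV[R]_q) :
  is_frame U theta lam al be -> (forall k, `|lam k| < pi) ->
  exists x t T, exists2 c : R, 0 <= c &
    [/\ horizontal_curve U x t (x0, T), curve_length x = c%:E &
        c ^+ 2 = phi U (x0, T) theta].
Proof.
move=> fr lpi.
pose a k := dotr (al k) x0; pose b k := dotr (be k) x0.
pose S k := sn (lam k) 1.
have S0 k : S k != 0 by rewrite gt_eqF // sn_gt0.
(* [fe + i fo = exp (- i l (s - 1)) * sn l s / sn l 1], with derivative [fe' + i fo']. *)
pose fe (l s : R) := cos (l * (s - 1)) * sn l s / sn l 1.
pose fo (l s : R) := - (sin (l * (s - 1)) * sn l s / sn l 1).
pose fe' (l s : R) := cos (l * (2 * s - 1)) / sn l 1.
pose fo' (l s : R) := - (sin (l * (2 * s - 1)) / sn l 1).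
have snN l p : sn (- l) p = sn l p :> R.
  by rewrite /sn oppr_eq0 mulNr sinN invrN mulrNN.
pose y (s : R) := comb al be x0 (fun k => fe (lam k) s) (fun k => fo (lam k) s).
pose v (s : R) := comb al be x0 (fun k => fe' (lam k) s) (fun k => fo' (lam k) s).
have daff (l c d s : R) : is_derive s 1 (fun r : R => l * (c * r - d)) (l * c).
  apply: is_derive_eq (is_deriveZ1 l (is_deriveD1 (is_deriveZ1 c (is_derive_id s 1)) (is_derive_cst (- d) s 1))) _.
  by rewrite addr0 mulr1.
have dcos (l c d s : R) : is_derive s 1 (fun r : R => cos (l * (c * r - d))) (- sin (l * (c * s - d)) * (l * c)).
  exact: (is_derive1_comp (f := cos) (g := fun r => l * (c * r - d)) (is_derive_cos _) (daff l c d s)).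
have dsin (l c d s : R) : is_derive s 1 (fun r : R => sin (l * (c * r - d))) (cos (l * (c * s - d)) * (l * c)).
  exact: (is_derive1_comp (f := sin) (g := fun r => l * (c * r - d)) (is_derive_sin _) (daff l c d s)).
have split2 (l s : R) : l * (2 * s - 1) = l * (s - 1) + l * s by ring.
have dfe k (s : R) : is_derive s 1 (fe (lam k)) (fe' (lam k) s).
  have H := is_deriveZ1 (S k)^-1 (is_deriveM1 (dcos (lam k) 1 1 s) (is_derive_sn (lam k) s)).
  rewrite (_ : fe _ = fun r => (S k)^-1 * (cos (lam k * (1 * r - 1)) * sn (lam k) r)); last first.
    by apply/funext => r; rewrite /fe mul1r mulrC.
  apply: is_derive_eq H _; rewrite /fe' split2 cosD (sin_sn _ s) !mul1r -/(S k); ring.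
have dfo k (s : R) : is_derive s 1 (fo (lam k)) (fo' (lam k) s).
  have H := is_deriveZ1 (- (S k)^-1) (is_deriveM1 (dsin (lam k) 1 1 s) (is_derive_sn (lam k) s)).
  rewrite (_ : fo _ = fun r => - (S k)^-1 * (sin (lam k * (1 * r - 1)) * sn (lam k) r)); last first.
    by apply/funext => r; rewrite /fo mul1r mulNr mulrC.
  by apply: is_derive_eq H _; rewrite /fo' split2 sinD (sin_sn _ s) !mul1r -/(S k); ring.
have dy (s : R) j : is_derive s 1 (fun r => y r 0 j) (v s 0 j).
  exact: (@is_derive_comb al be x0 (fun k => fe (lam k)) (fun k => fo (lam k))
    (fun k => fe' (lam k)) (fun k => fo' (lam k)) s j (dfe^~ s) (dfo^~ s)).
have dv (s : R) j : exists v2, is_derive s 1 (fun r => v r 0 j) v2.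
  eexists; apply: (is_derive_comb al be x0 (E := fun k => fe' (lam k)) (O := fun k => fo' (lam k))
    (E' := fun k s => - sin (lam k * (2 * s - 1)) * (lam k * 2) * (S k)^-1)
    (O' := fun k s => - (cos (lam k * (2 * s - 1)) * (lam k * 2) * (S k)^-1))) => k.
    apply: is_derive_eq (is_deriveM1 (dcos (lam k) 2 1 s) (is_derive_cst (S k)^-1 s 1)) _.
    by rewrite mulr0 add0r mulrC.
  rewrite (_ : fo' _ = fun r => -1 * (sin (lam k * (2 * r - 1)) * (S k)^-1)); last first.
    by apply/funext => r; rewrite mulN1r.
  apply: is_derive_eq (is_deriveZ1 (-1) (is_deriveM1 (dsin (lam k) 2 1 s) (is_derive_cst (S k)^-1 s 1))) _.
  by rewrite mulr0 add0r mulN1r mulrC.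
have feN (s : R) l : fe (- l) s = fe l s by rewrite /fe !snN mulNr cosN.
have foN (s : R) l : fo (- l) s = - fo l s by rewrite /fo !snN mulNr sinN !mulNr.
have fe'N (s : R) l : fe' (- l) s = fe' l s by rewrite /fe' !snN mulNr cosN.
have fo'N (s : R) l : fo' (- l) s = - fo' l s by rewrite /fo' !snN mulNr sinN !mulNr.
have yc (s : R) k := frame_fun fr (e := fe^~ s) (o := fo^~ s) (x := x0) (feN s) (foN s) (erefl (y s)) k.
have vc (s : R) k := frame_fun fr (e := fe'^~ s) (o := fo'^~ s) (x := x0) (fe'N s) (fo'N s) (erefl (v s)) k.
rewrite /= in yc vc.
have cv j : continuous (fun s => v s 0 j : R).
  by apply: derivable_continuous => s; have [v2 []] := dv s j.
have ch j : continuous (fun s => 2^-1 * brk U (y s) (v s) 0 j : R).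
  apply: derivable_continuous => s.
  rewrite (_ : (fun s => _) = fun s => 2^-1 * \sum_a \sum_b (U j a b * y s 0 b) * v s 0 a); last first.
    by apply/funext => r; rewrite !mxE.
  have /fin_all_exists[v2 dv2] : forall a, exists v2, is_derive s 1 (fun r => v r 0 a) v2.
    by move=> a'; exact: dv.
  by have [] := is_deriveZ1 2^-1 (is_derive_sum1 (fun a => is_derive_sum1 (fun b =>
    is_deriveM1 (is_deriveZ1 (U j a b) (dy s b)) (dv2 a)))).
have /fin_all_exists[H HH] : forall j, exists H : R -> R, H 0 = 0 /\
    forall s : R, 0 <= s -> s <= 1 -> is_derive s 1 H (2^-1 * brk U (y s) (v s) 0 j).
  by move=> j; exact: antiderivative01.
pose t (s : R) : 'rV[R]_m := \row_j H j s.
have dt j (s : R) : 0 <= s -> s <= 1 ->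
    is_derive s 1 (fun r => t r 0 j) (2^-1 * brk U (y s) (v s) 0 j).
  move=> s0 s1; rewrite (_ : (fun r => _) = H j); first by case: (HH j) => _; apply.
  by apply/funext => r; rewrite mxE.
have Dy (s : R) : derivable y s 1 /\ 'D_1 y s = v s.
  have Dy : derivable y s 1.
    by apply/derivable_mxP => i j; rewrite ord1; case: (dy s j).
  split => //; apply/rowP => j; rewrite derive_mx // mxE.
  by case: (dy s j).
have Dt (s : R) : 0 <= s -> s <= 1 -> derivable t s 1 /\ 'D_1 t s = 2^-1 *: brk U (y s) (v s).
  move=> s0 s1; have Dt : derivable t s 1.
    by apply/derivable_mxP => i j; rewrite ord1; case: (dt j s s0 s1).
  split => //; apply/rowP => j; rewrite derive_mx // mxE [RHS]mxE.
  by case: (dt j s s0 s1).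
pose c2 := \sum_k (a k ^+ 2 + b k ^+ 2) / S k ^+ 2.
have vE (s : R) : dotr (v s) (v s) = c2.
  rewrite (frame_dotr fr); apply: eq_bigr => k _.
  have [-> ->] := vc s k; rewrite /fe' /fo' -/(S k) -/(a k) -/(b k).
  transitivity ((cos (lam k * (2 * s - 1)) ^+ 2 + sin (lam k * (2 * s - 1)) ^+ 2)
     * ((a k ^+ 2 + b k ^+ 2) / S k ^+ 2)); first by field.
  by rewrite cos2Dsin2 mul1r.
have sn0 l : sn l 0 = 0 :> R by rewrite /sn mulr0 sin0 mul0r if_same.
have y0 : y 0 = 0.
  rewrite /y /comb big1 // => k _; rewrite /fe /fo sn0 !(mulr0, mul0r, oppr0, subrr, addr0, scale0r).
  by [].
have y1 : y 1 = x0.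
  (* The 2 q vectors [al k], [be k] of R^q form a Parseval frame, not a basis, so equality is tested
     on scalar products. *)
  have E z : dotr (y 1) z = dotr x0 z.
    rewrite !(frame_dotr fr); apply: eq_bigr => k _.
    have [-> ->] := yc 1 k; rewrite /fe /fo subrr mulr0 cos0 sin0 -/(S k).
    by field.
  apply/rowP => j; have := E (delta_mx 0 j); rewrite /dotr.
  rewrite (bigD1 j) //= [X in _ = X](bigD1 j) //= !mxE !eqxx !mulr1 !big1 ?addr0 //.
    by move=> i ij; rewrite mxE eqxx (negbTE ij) mulr0.
  by move=> i ij; rewrite mxE eqxx (negbTE ij) mulr0.
exists y, t, (t 1), (Num.sqrt c2); first exact: sqrtr_ge0.
split.
- split.
  + split; first by apply: (C1_abs_cont cv) => j s _ _; exact: dy.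
    by apply: (C1_abs_cont ch) => j s; exact: dt.
  + by split => //; apply/rowP => j; rewrite !mxE; case: (HH j).
  + by [].
  + apply: aeW => s /=; rewrite in_itv /= => /andP[s0 s1].
    by have [d1 ->] := Dy s; have [d2 ->] := Dt s s0 s1.
- rewrite /curve_length (_ : (fun s => _) = fun=> (Num.sqrt c2)%:E).
    rewrite integral_cst //= lebesgue_measure_itv /= lte_fin ltr01 oppr0 addr0.
    by rewrite mule1.
  apply/funext => s; have [_ ->] := Dy s; congr (_%:E).
  by rewrite -(vE s) -enorm_sqr sqrtr_sqr ger0_norm // sqrtr_ge0.
- have c20 : 0 <= c2 by apply: sumr_ge0 => k _; rewrite divr_ge0 ?addr_ge0 ?sqr_ge0.
  rewrite sqr_sqrtr // (frame_phi fr) /= -/(a _).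
  (* [ps k] is an antiderivative of the contribution of [k] to [4 theta . t']. *)
  pose ps k (s : R) := (s - sn (lam k) s * cos (lam k * s)) * ((a k ^+ 2 + b k ^+ 2) / S k ^+ 2).
  pose Psi (s : R) := 4 * dotr theta (t s) - \sum_k ps k s.
  have dPsi (s : R) : 0 <= s -> s <= 1 -> is_derive s 1 Psi 0 /\ `|0 : R| <= 0.
    move=> s0 s1; split; last by rewrite normr0.
    have [Dts DtE] := Dt s s0 s1.
    have dps k : is_derive s 1 (ps k) (2 * (lam k * sn (lam k) s * sin (lam k * s))
        * ((a k ^+ 2 + b k ^+ 2) / S k ^+ 2)).
      have D1 := is_deriveM1 (is_derive_sn (lam k) s) (is_derive_cosl (lam k) s).
      have D2 := is_deriveM1 (is_deriveD1 (is_derive_id s 1) (is_deriveZ1 (-1) D1))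
        (is_derive_cst ((a k ^+ 2 + b k ^+ 2) / S k ^+ 2) s 1).
      rewrite (_ : ps k = fun r => (r + -1 * (sn (lam k) r * cos (lam k * r)))
        * ((a k ^+ 2 + b k ^+ 2) / S k ^+ 2)); last first.
        by apply/funext => r; rewrite /ps mulN1r.
      apply: is_derive_eq D2 _; rewrite mulr0 add0r mulrC; congr (_ * _).
      rewrite -[X in X + _](cos2_sn2 (lam k) s) sin_sn; ring.
    have D := is_deriveD1 (is_deriveZ1 4 (is_derive_dotr theta Dts))
      (is_deriveZ1 (-1) (is_derive_sum1 dps)).
    rewrite (_ : Psi = fun r => 4 * dotr theta (t r) + -1 * \sum_k ps k r); last first.
      by apply/funext => r; rewrite mulN1r.
    apply: is_derive_eq D _; rewrite DtE dotrZr (frame_brk fr) mulN1r mulrA mulr_sumr -sumrB.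
    apply: big1 => k _; have [-> ->] := yc s k; have [-> ->] := vc s k.
    have -> : sin (lam k * s) = sin (lam k * (2 * s - 1)) * cos (lam k * (s - 1))
        - cos (lam k * (2 * s - 1)) * sin (lam k * (s - 1)).
      by rewrite -sinB; congr sin; ring.
    by rewrite /fe /fo /fe' /fo' -/(S k) -/(a k) -/(b k); field.
  have := lipschitz01 (f' := fun=> 0) dPsi (lexx 0) ler01 (lexx 1).
  rewrite mul0r normr_le0 subr_eq0 => /eqP.
  have -> : Psi 0 = 0.
    rewrite /Psi (_ : t 0 = 0); last by apply/rowP => j; rewrite !mxE; case: (HH j).
    by rewrite dotr0 mulr0 big1 ?subrr // => k _; rewrite /ps sn0 mul0r subrr mul0r.
  move=> /eqP; rewrite subr_eq0 => /eqP ->; rewrite /c2 -big_split /=.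
  (* As [Psi] vanishes at 1, mode k contributes (1 - S k cos l) / S k ^ 2 through 4 theta . T and
     cos l / S k through [zcotz], in units of a k ^ 2 + b k ^ 2; the sum is 1 / S k ^ 2. *)
  apply: eq_bigr => k _; rewrite zcotz_ctg /ctg /ps mulr1 -/(S k) -/(a k) -/(b k).
  by field.
Qed.

End Extremal.

(** * Divided differences and differentiability of z cot z *)

Section DerivableZcotz.
Variable R : realType.

Definition divdiff (f : R -> R) (a z : R) : R :=
  if z == a then 'D_1 f a else (f z - f a) / (z - a).

Lemma divdiff_cvg (f : R -> R) a : derivable f a 1 ->
  forall e : R, 0 < e -> exists2 d : R, 0 < d & forall z : R, `|z - a| < d ->
    `|divdiff f a z - divdiff f a a| < e.
Proof.
move=> da e e0.
have : h^-1 *: ((f \o shift a) (h *: 1) - f a) @[h --> 0^'] --> 'D_1 f a by exact: da.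
move=> /cvgrPdist_lt/(_ _ e0); rewrite near_withinE => /nbhs_ballP[d /= d0 dP].
exists d => // z zd; rewrite /divdiff eqxx; case: (eqVneq z a) => [E|za].
  by rewrite ?E subrr normr0.
have := dP (z - a); rewrite /ball /= sub0r normrN subr_eq0 => /(_ zd za).
by rewrite distrC /GRing.scale /= mulr1 subrK mulrC.
Qed.

Lemma divdiff_continuous (f : R -> R) a z : derivable f a 1 -> derivable f z 1 ->
  {for z, continuous (divdiff f a)}.
Proof.
move=> da dz; have [->|za] := eqVneq z a.
  apply/cvgrPdist_lt => e e0; have [d d0 H] := divdiff_cvg da e0.
  near=> r; rewrite distrC; apply: H; rewrite distrC.
  by near: r; apply: cvgr_dist_lt.
have cf : {for z, continuous f} by apply: differentiable_continuous; exact/derivable1_diffP.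
have E : \forall r \near z, (f r - f a) / (r - a) = divdiff f a r.
  have zad : 0 < `|z - a| by rewrite normr_gt0 subr_eq0.
  near=> r; rewrite /divdiff ifN_eq //; apply/eqP => ra.
  have : `|z - r| < `|z - a| by near: r; apply: cvgr_dist_lt.
  by rewrite ra ltxx.
apply: cvg_trans; first by apply: near_eq_cvg; exact: E.
rewrite (_ : divdiff f a z = (f z - f a) / (z - a)); last by rewrite /divdiff ifN_eq.
apply: cvgM; first by apply: cvgB => //; exact: cvg_cst.
apply: cvgV; first by rewrite subr_eq0.
by apply: cvgB; [exact: cvg_id | exact: cvg_cst].
Unshelve. all: by end_near. Qed.

Lemma divdiff_bounded (f : R -> R) a r : 0 <= r -> `|a| <= r ->
  (forall z : R, `|z| <= r -> derivable f z 1) ->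
  exists M : R, 0 <= M /\ forall z : R, `|z| <= r -> `|divdiff f a z| <= M.
Proof.
move=> r0 ar df.
have cd : {within `[- r, r], continuous (fun z => `|divdiff f a z|)}.
  apply: continuous_in_subspaceT => z; rewrite inE /= in_itv /= -ler_norml => zr.
  exact: cvg_norm (divdiff_continuous (df a ar) (df z zr)).
have rr : - r <= r by lra.
have [c _ Hc] := EVT_max rr cd.
by exists `|divdiff f a c|; split => // z zr; apply: Hc; rewrite in_itv /= -ler_norml.
Qed.

Lemma sn1_0 : sn 0 1 = 1 :> R. Proof. by rewrite /sn eqxx. Qed.

(** As cos' 0 = 0, |cos c - 1| <= e |c| near 0. The mean value theorem then gives |sin h - h| <= e h
    ^ 2, so the difference quotient of sin h / h tends to 0. *)
Lemma derivable_sinc : derivable (fun l : R => sn l 1) 0 1.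
Proof.
apply/cvg_ex; exists 0; apply/cvgrPdist_le => e e0.
have [d d0 Hd] := divdiff_cvg (ex_derive (is_derive := is_derive_cos 0)) e0.
have cosB (c : R) : `|c| < d -> `|cos c - 1| <= e * `|c|.
  move=> cd; have [->|c0] := eqVneq c 0; first by rewrite cos0 subrr normr0 mulr0.
  have := Hd c; rewrite subr0 /divdiff eqxx (negbTE c0) => /(_ cd).
  rewrite (@derive_val _ _ _ _ _ _ _ (is_derive_cos (0 : R))) sin0 cos0 oppr0 !addr0 subr0.
  by rewrite normrM normfV ltr_pdivrMr ?normr_gt0 // => /ltW.
near=> h.
have hd : `|h| < d by near: h; apply: dnbhs0_lt.
have h0 : h != 0 by near: h; exact: nbhs_dnbhs_neq.
have dpsi (c : R) : is_derive c 1 (fun s : R => sin s - s) (cos c - 1).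
  exact: is_deriveB.
have bd (u v : R) : u <= v -> (forall c : R, u <= c -> c <= v -> `|c| <= `|h|) ->
    `|(sin v - v) - (sin u - u)| <= e * `|h| * (v - u).
  move=> uv H.
  have cf : {within `[u, v], continuous (fun s : R => sin s - s)}.
    by apply: derivable_within_continuous => c _; case: (dpsi c).
  have [c cuv ->] := MVT_segment uv (fun c _ => dpsi c) cf.
  move: cuv; rewrite in_itv /= => /andP[uc cv].
  rewrite normrM (ger0_norm (_ : 0 <= v - u)) ?subr_ge0 // ler_wpM2r ?subr_ge0 //.
  apply: le_trans (cosB c _) _; first by apply: le_lt_trans hd; exact: H.
  by apply: ler_wpM2l; [exact: ltW | exact: H].
have key : `|sin h - h| <= e * `|h| * `|h|.
  have [hneg|hpos] := ltP h 0.
    have := bd h 0 (ltW hneg); rewrite sin0 subrr sub0r normrN sub0r -(ltr0_norm hneg).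
    by apply => c hc c0; rewrite (ler0_norm c0) (ltr0_norm hneg) lerN2.
  have := bd 0 h hpos; rewrite sin0 subrr !subr0 -[X in _ * X](ger0_norm hpos).
  by apply => c c0 hc; rewrite (ger0_norm c0) (ger0_norm hpos).
rewrite sub0r normrN /GRing.scale /= mulr1 addr0 sn1_0 /sn (negbTE h0) mulr1.
have -> : h^-1 * (sin h / h - 1) = (sin h - h) / (h * h) by field.
by rewrite normrM normfV ler_pdivrMr ?normr_gt0 ?mulf_neq0 // normrM mulrA.
Unshelve. all: by end_near. Qed.

Lemma derivable_zcotz (z : R) : `|z| < pi -> derivable (@zcotz R) z 1.
Proof.
move=> zpi; have -> : @zcotz R = fun l => cos l * (sn l 1)^-1.
  by apply/funext => l; rewrite zcotz_ctg /ctg mulr1.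
have s0 : sn z 1 != 0 by rewrite gt_eqF // sn_gt0.
have ds : derivable (fun l : R => sn l 1) z 1.
  have [->|z0] := eqVneq z 0; first exact: derivable_sinc.
  have dq : is_derive z 1 (fun l : R => sin l * l^-1) (sin z * (- z ^- 2 *: 1) + z^-1 * cos z).
    by apply: is_deriveM1; exact: is_deriveV.
  have E : \forall r \near z, sin r * r^-1 = sn r 1.
    near=> r; rewrite /sn mulr1 ifN_eq //.
    by near: r; exact: (cvgr_neq0 z).
  have dq' : derivable (fun l : R => sin l * l^-1) z 1 by case: dq.
  exact: (near_eq_derivable E dq').
have dc : derivable (@cos R) z 1 by case: (is_derive_cos z).
have di : derivable (fun l : R => (sn l 1)^-1) z 1.
  exact: (derivableV (f := fun l : R => sn l 1) s0 ds).
exact: derivableM dc di.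
Unshelve. all: by end_near. Qed.

End DerivableZcotz.

(** * Perturbation of the functional calculus *)

Section Perturbation.
Variables (R : realType) (q : nat).
Local Notation C := R[i].
Local Notation nc := (@ComplexField.Normc.normc R).
Local Open Scope complex_scope.

Definition nrm n p (A : 'M[C]_(n, p)) : R := \sum_i \sum_j nc (A i j).

Lemma nc_ge0 (z : C) : 0 <= nc z. Proof. by case: z => a b; exact: sqrtr_ge0. Qed.

Lemma nc_real (r : R) : nc (toC r) = `|r|.
Proof. by rewrite /= expr0n addr0 sqrtr_sqr. Qed.

Lemma nc_sqr (z : C) : nc z ^+ 2 = cnorm2 z.
Proof. by case: z => a b; rewrite /= sqr_sqrtr // addr_ge0 ?sqr_ge0. Qed.

Lemma Re_nc (z : C) : `|complex.Re z| <= nc z.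
Proof. by case: z => a b /=; rewrite -sqrtr_sqr ler_wsqrtr // lerDl sqr_ge0. Qed.

Lemma nc_sum I (r : seq I) (F : I -> C) : nc (\sum_(i <- r) F i) <= \sum_(i <- r) nc (F i).
Proof.
elim/big_ind2 : _ => [|a b c d ab cd|//]; first by rewrite ComplexField.Normc.normc0.
by apply: le_trans (lerD ab cd); exact: (@le_normcD R b d).
Qed.

Lemma nrm_ge0 n p (A : 'M[C]_(n, p)) : 0 <= nrm A.
Proof. by apply: sumr_ge0 => i _; apply: sumr_ge0 => j _; exact: nc_ge0. Qed.

Lemma nc_le_nrm n p (A : 'M[C]_(n, p)) i j : nc (A i j) <= nrm A.
Proof.
rewrite /nrm (bigD1 i) //= (bigD1 j) //= -addrA lerDl addr_ge0 //.
  by apply: sumr_ge0 => *; exact: nc_ge0.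
by apply: sumr_ge0 => *; apply: sumr_ge0 => *; exact: nc_ge0.
Qed.

Lemma nrmM n p r (A : 'M[C]_(n, p)) (B : 'M[C]_(p, r)) : nrm (A *m B) <= nrm A * nrm B.
Proof.
rewrite /nrm mulr_suml; apply: ler_sum => i _.
apply: (@le_trans _ _ (\sum_j \sum_k nc (A i k) * nc (B k j))).
  apply: ler_sum => j _; rewrite mxE; apply: le_trans (nc_sum _ _) _.
  by apply: ler_sum => k _; rewrite ComplexField.Normc.normcM.
rewrite exchange_big /= mulr_suml; apply: ler_sum => k _.
rewrite -mulr_sumr ler_wpM2l ?nc_ge0 // [leRHS](bigD1 k) //= lerDl.
by apply: sumr_ge0 => *; apply: sumr_ge0 => *; exact: nc_ge0.
Qed.

Lemma nrm_adj n p (A : 'M[C]_(n, p)) : nrm (adj A) = nrm A.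
Proof.
rewrite /nrm exchange_big /=; apply: eq_bigr => i _; apply: eq_bigr => j _.
by rewrite adjE; case: (A i j) => a b /=; rewrite sqrrN.
Qed.

(** Bounds [nrm] of every unitary matrix of size q, whose entries have modulus at most 1. *)
Let N : R := q%:R * q%:R.

Lemma nrm_le_const (A : 'M[C]_q) c : (forall i j, nc (A i j) <= c) -> nrm A <= N * c.
Proof.
move=> Ac; apply: (@le_trans _ _ (\sum_(i < q) \sum_(j < q) c)).
  by apply: ler_sum => i _; apply: ler_sum => j _.
by rewrite !sumr_const !card_ord /N -mulrA !mulr_natl.
Qed.

Lemma unitary_row (A : 'M[C]_q) i : A *m adj A = 1%:M -> \sum_a cnorm2 (A i a) = 1.
Proof.
move=> A1; apply: (@toC_inj R); rewrite /toC rmorph_sum.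
transitivity ((A *m adj A) i i); last by rewrite A1 mxE eqxx.
by rewrite mxE; apply: eq_bigr => a _; rewrite adjE mulrC -cnorm2E.
Qed.

Lemma unitary_col (A : 'M[C]_q) i : adj A *m A = 1%:M -> \sum_a cnorm2 (A a i) = 1.
Proof.
move=> A1; apply: (@toC_inj R); rewrite /toC rmorph_sum.
transitivity ((adj A *m A) i i); last by rewrite A1 mxE eqxx.
by rewrite mxE; apply: eq_bigr => a _; rewrite adjE -cnorm2E.
Qed.

Lemma nc_unitary (A : 'M[C]_q) i j : A *m adj A = 1%:M -> nc (A i j) <= 1.
Proof.
move=> /(unitary_row i); rewrite (bigD1 j) //= => E.
rewrite -(@expr_le1 _ 2) ?nc_ge0 // nc_sqr -E lerDl.
by apply: sumr_ge0 => *; exact: cnorm2_ge0.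
Qed.

Lemma nrm_unitary (P : 'M[C]_q) : P *m adj P = 1%:M -> nrm P <= N.
Proof. by move=> P1; rewrite -[leRHS]mulr1; apply: nrm_le_const => i j; exact: nc_unitary. Qed.

Lemma adjK n p (A : 'M[C]_(n, p)) : adj (adj A) = A.
Proof. by apply/matrixP => i j; rewrite !adjE conjcK. Qed.

Lemma delta_mulE (A : 'M[C]_q) k i l :
  (delta_mx k k *m A) i l = if i == k then A k l else 0.
Proof.
rewrite mxE (bigD1 k) //= big1 => [|j jk]; last by rewrite mxE (negbTE jk) andbF mul0r.
by rewrite mxE eqxx andbT addr0; case: eqP => _; rewrite ?mul1r ?mul0r.
Qed.

Variables (H D P Q : 'M[C]_q) (lam mu : 'I_q -> R) (h : R).
Hypothesis sdP : specdec H P lam.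
Hypothesis sdQ : specdec (H + toC h *: D) Q mu.

Lemma specdec_mul (K V : 'M[C]_q) nu : specdec K V nu ->
  V *m K = diag_mx (\row_k toC (nu k)) *m V /\ K *m adj V = adj V *m diag_mx (\row_k toC (nu k)).
Proof.
case=> V1 V2 ->; split; first by rewrite !mulmxA V1 mul1mx.
by rewrite -!mulmxA V1 mulmx1.
Qed.

(** Evaluate P (H + h D) Q^* in two ways: [P] diagonalizes [H] on the left, [Q] the perturbed matrix
    on the right. Eigenvectors for well separated eigenvalues are thus almost orthogonal when h is
    small. *)
Lemma overlap k l :
  toC (mu l - lam k) * (P *m adj Q) k l = toC h * (P *m D *m adj Q) k l.
Proof.
have [PH _] := specdec_mul sdP; have [_ KQ] := specdec_mul sdQ.
have E : P *m (H + toC h *: D) *m adj Q = P *m H *m adj Q + toC h *: (P *m D *m adj Q).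
  by rewrite mulmxDr mulmxDl -scalemxAr -scalemxAl.
have := congr1 (fun A : 'M[C]_q => A k l) E.
rewrite -mulmxA KQ mulmxA PH -[diag_mx _ *m P *m _]mulmxA mul_mx_diag mul_diag_mx.
rewrite /= [LHS]mxE [X in _ * X]mxE [X in _ = X]mxE [X in _ = X + _]mxE [X in _ = X * _ + _]mxE.
rewrite [X in _ = _ + X]mxE => E2.
rewrite /toC rmorphB /= mulrBl [X in X - _]mulrC.
by rewrite -/(toC (mu l)) E2 addrC addKr.
Qed.

Lemma nrm_conjugate : nrm (P *m D *m adj Q) <= N * nrm D * N.
Proof.
have [P1 _ _] := sdP; have [Q1 _ _] := sdQ.
apply: le_trans (nrmM _ _) _; apply: ler_pM; rewrite ?nrm_ge0 ?nrm_adj ?nrm_unitary //.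
by apply: le_trans (nrmM _ _) _; rewrite ler_wpM2r ?nrm_ge0 ?nrm_unitary.
Qed.

Lemma perturbed_eigenvalue r : (forall k, `|lam k| <= r) ->
  forall l, `|mu l| <= r + `|h| * (N * nrm D * N).
Proof.
move=> lr l; have [P1 P2 HE] := sdP; have [Q1 Q2 _] := sdQ.
have [QK _] := specdec_mul sdQ.
have E : Q *m (H + toC h *: D) *m adj Q =
    adj (P *m adj Q) *m (diag_mx (\row_k toC (lam k)) *m (P *m adj Q)) + toC h *: (Q *m D *m adj Q).
  rewrite mulmxDr mulmxDl -scalemxAr -scalemxAl; congr (_ + _).
  by rewrite adjM adjK {1}HE !mulmxA.
have q1 : \sum_k cnorm2 ((P *m adj Q) k l) = 1.
  by apply: unitary_col; rewrite adjM adjK -mulmxA (mulmxA (adj P)) P2 mul1mx.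
have := congr1 (fun A : 'M[C]_q => A l l) E.
rewrite QK -mulmxA Q1 mulmx1 /= mxE eqxx mulr1n mxE [RHS]mxE [X in _ = X + _]mxE [X in _ = _ + X]mxE.
rewrite (_ : \sum_j _ = toC (\sum_k lam k * cnorm2 ((P *m adj Q) k l))); last first.
  rewrite /toC rmorph_sum; apply: eq_bigr => k _.
  by rewrite mul_diag_mx adjE [X in _ * X]mxE [X in _ * (X * _)]mxE mulrCA -cnorm2E -rmorphM.
move=> /(congr1 (@complex.Re R)) /= ->.
have ReZ (z : C) : complex.Re (toC h * z) = h * complex.Re z.
  by case: z => a b /=; rewrite mul0r subr0.
have -> z w : complex.Re (toC z + w) = z + complex.Re w by case: w.
rewrite ReZ; apply: le_trans (ler_normD _ _) _; apply: lerD.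
  apply: le_trans (ler_norm_sum _ _ _) _; rewrite -[leRHS]mulr1 -q1 mulr_sumr.
  apply: ler_sum => k _; rewrite normrM (ger0_norm (cnorm2_ge0 _)).
  by rewrite ler_wpM2r ?cnorm2_ge0.
rewrite normrM ler_wpM2l //; apply: le_trans (Re_nc _) _.
apply: le_trans (nc_le_nrm _ _ _) _.
apply: le_trans (nrmM _ _) _; apply: ler_pM; rewrite ?nrm_ge0 ?nrm_adj ?nrm_unitary //.
by apply: le_trans (nrmM _ _) _; rewrite ler_wpM2r ?nrm_ge0 ?nrm_unitary.
Qed.

Definition gap (f : R -> R) : 'M[C]_q :=
  \matrix_(k, l) (toC (f (mu l) - f (lam k)) * (P *m adj Q) k l).

Lemma fcalcB f : fcalc f Q mu - fcalc f P lam = adj P *m gap f *m Q.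
Proof.
have [P1 P2 _] := sdP; have [Q1 Q2 _] := sdQ.
have -> : gap f = P *m adj Q *m diag_mx (\row_k toC (f (mu k)))
    - diag_mx (\row_k toC (f (lam k))) *m (P *m adj Q).
  apply/matrixP => k l; rewrite [LHS]mxE mul_mx_diag mul_diag_mx.
  move: (P *m adj Q) => A; rewrite !mxE /toC rmorphB /=.
  by rewrite mulrBl [A k l * _]mulrC.
have e1 : adj P *m (P *m adj Q *m diag_mx (\row_k toC (f (mu k)))) *m Q = fcalc f Q mu.
  by rewrite !mulmxA P2 mul1mx.
have e2 : adj P *m (diag_mx (\row_k toC (f (lam k))) *m (P *m adj Q)) *m Q = fcalc f P lam.
  by rewrite -!mulmxA Q2 mulmx1 /fcalc mulmxA.
by rewrite mulmxBr mulmxBl e1 e2.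
Qed.

(** For each pair k, l, either [mu l] is close to [lam k] and F varies little, or the overlap of the
    eigenvectors is small by [overlap]. Hence no matching between the two spectra is required. *)
Lemma fcalc_close (F : R -> R) (r M d e : R) :
  0 < d -> 0 <= M -> (forall k, `|lam k| <= r) -> (forall l, `|mu l| <= r) ->
  (forall z, `|z| <= r -> `|F z| <= M) ->
  (forall k z, `|z - lam k| < d -> `|F z - F (lam k)| <= e) ->
  2 * M * (`|h| * (N * nrm D * N)) <= e * d ->
  nrm (fcalc F Q mu - fcalc F P lam) <= N * (N * e) * N.
Proof.
move=> d0 M0 lr mr FM Fd hd; have [P1 _ _] := sdP; have [Q1 _ _] := sdQ.
have q1 k l : nc ((P *m adj Q) k l) <= 1.
  by have [_ Q2 _] := sdQ; apply: nc_unitary; rewrite adjM adjK -mulmxA (mulmxA (adj Q)) Q2 mul1mx.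
have gapb k l : nc (gap F k l) <= e.
  rewrite mxE ComplexField.Normc.normcM nc_real.
  have [near_k|far_k] := ltP `|mu l - lam k| d.
    apply: le_trans (Fd k _ near_k); rewrite ler_piMr //; exact: q1.
  have qs : `|mu l - lam k| * nc ((P *m adj Q) k l) <= `|h| * (N * nrm D * N).
    rewrite -nc_real -ComplexField.Normc.normcM overlap ComplexField.Normc.normcM nc_real.
    rewrite ler_wpM2l //; apply: le_trans (nc_le_nrm _ _ _) _; exact: nrm_conjugate.
  have F2 : `|F (mu l) - F (lam k)| <= 2 * M.
    apply: le_trans (ler_normB _ _) _.
    by have := FM _ (mr l); have := FM _ (lr k); lra.
  rewrite -(ler_pM2r d0); apply: le_trans hd.
  apply: (@le_trans _ _ (2 * M * nc ((P *m adj Q) k l) * d)).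
    by rewrite (ler_pM2r d0); apply: (ler_wpM2r (nc_ge0 _) F2).
  rewrite -[leLHS]mulrA; apply: ler_wpM2l; first by rewrite mulr_ge0.
  by apply: le_trans qs; rewrite mulrC; apply: (ler_wpM2r (nc_ge0 _) far_k).
rewrite fcalcB; apply: le_trans (nrmM _ _) _; apply: ler_pM; rewrite ?nrm_ge0 ?nrm_unitary //.
apply: le_trans (nrmM _ _) _; apply: ler_pM; rewrite ?nrm_ge0 ?nrm_adj ?nrm_unitary //.
exact: nrm_le_const.
Qed.

(** [overlap] trades each increment of f for h times a divided difference, exactly and for every h.
    The base point [lam k] depends on the row, whence the sum over row projections
    [delta_mx k k]. *)
Lemma fcalcB_divdiff f : fcalc f Q mu - fcalc f P lam = toC h *:
  \sum_k (adj P *m delta_mx k k *m P *m D) *m fcalc (divdiff f (lam k)) Q mu.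
Proof.
rewrite fcalcB.
have -> : gap f = toC h *: \sum_k delta_mx k k *m
    ((P *m D *m adj Q) *m diag_mx (\row_l toC (divdiff f (lam k) (mu l)))).
  apply/matrixP => k l; rewrite [LHS]mxE [RHS]mxE summxE (bigD1 k) //= big1 ?addr0; last first.
    by move=> i ik; rewrite delta_mulE eq_sym (negbTE ik).
  rewrite delta_mulE eqxx mul_mx_diag.
  have O := overlap k l.
  move: (P *m adj Q) (P *m D *m adj Q) O => A W O.
  rewrite [X in _ = _ * X]mxE [X in _ = _ * (_ * X)]mxE mulrA -O.
  rewrite /divdiff; case: eqVneq => [->|ml].
    by rewrite !subrr !mul0r.
  rewrite mulrAC -rmorphM; congr (toC _ * _).
  by rewrite mulrC divfK // subr_eq0.
rewrite -scalemxAr -scalemxAl; congr (_ *: _).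
rewrite mulmx_sumr mulmx_suml; apply: eq_bigr => k _.
by rewrite /fcalc !mulmxA.
Qed.

End Perturbation.

(** * Directional derivatives of phi *)

Section DerivablePhi.
Variables (R : realType) (q m : nat) (U : 'I_m -> 'M[R]_q).
Hypothesis hskew : skew_family U.
Local Notation C := R[i].
Local Open Scope complex_scope.

Lemma fin_delta (I : finType) (Q : I -> R -> Prop) :
  (forall i, exists2 d : R, 0 < d & Q i d) ->
  (forall i (d d' : R), d' <= d -> Q i d -> Q i d') ->
  exists2 d : R, 0 < d & forall i, Q i d.
Proof.
move=> Qe Qm.
have /fin_all_exists[d Hd] : forall i, exists d : R, 0 < d /\ Q i d.
  by move=> i; have [e e0 Qi] := Qe i; exists e.
have d0 i : 0 < d i by case: (Hd i).
(* The radius 1 / (1 + sum of the 1 / d i) lies below every d i, and is positive even for an empty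
   family. *)
pose s := \sum_i (d i)^-1; have s0 : 0 <= s by apply: sumr_ge0 => i _; rewrite invr_ge0 ltW.
exists (s + 1)^-1 => [|i]; first by rewrite invr_gt0 ltr_wpDl.
apply: (Qm i (d i)); last by case: (Hd i).
rewrite -[leRHS]invrK lef_pV2 ?posrE ?invr_gt0 ?ltr_wpDl //.
rewrite /s (bigD1 i) //= -addrA lerDl addr_ge0 //.
by apply: sumr_ge0 => k _; rewrite invr_ge0 ltW.
Qed.

Lemma Umat_line theta j h :
  Umat U (h *: ej R j + theta) = Umat U theta + toC h *: Umat U (ej R j).
Proof.
apply/matrixP => a b; rewrite [RHS]mxE [X in _ = _ + X]mxE !Umat_entry.
apply/eqP; rewrite eq_complex /=; apply/andP; split; apply/eqP; first by ring.
rewrite mul0r addr0 mulr_sumr -big_split /=; apply: eq_bigr => k _.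
by rewrite !mxE; ring.
Qed.

Lemma specdec_near theta j P lam : specdec (Umat U theta) P lam ->
  (forall k, `|lam k| < pi) -> exists r d : R, [/\ 0 <= r, r < pi, 0 < d,
    forall k, `|lam k| <= r &
    forall h Q mu, `|h| < d -> specdec (Umat U (h *: ej R j + theta)) Q mu ->
      forall l, `|mu l| <= r].
Proof.
move=> sd lpi.
have [r0 [r00 r0pi lr0]] : exists r0 : R, [/\ 0 <= r0, r0 < pi & forall k, `|lam k| <= r0].
  have [d d0 Hd] : exists2 d : R, 0 < d & forall k, `|lam k| <= pi - d.
    apply: (@fin_delta _ (fun k d => `|lam k| <= pi - d)) => [k|k d d' dd' H].
      by exists (pi - `|lam k|); rewrite ?subr_gt0 // opprB addrC subrK.
    by apply: le_trans H _; rewrite lerD2l lerN2.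
  have pi0 := pi_gt0 R.
  exists (Num.max 0 (pi - d)); split; first by rewrite le_max lexx.
    by rewrite gt_max pi0 ltrBlDr ltrDl.
  by move=> k; rewrite le_max Hd orbT.
pose K := q%:R * q%:R * nrm (Umat U (ej R j)) * (q%:R * q%:R).
have K0 : 0 <= K by rewrite !mulr_ge0 ?nrm_ge0.
(* [r] is halfway between the bound [r0] of the spectrum and pi, and the second witness keeps the
   displacement |h| K of the eigenvalues below half of that gap. *)
exists ((r0 + pi) / 2), ((pi - r0) / 2 / (K + 1)); split; try lra.
- by rewrite !divr_gt0 ?subr_gt0 // ltr_wpDl.
- by move=> k; apply: le_trans (lr0 k) _; lra.
move=> h Q mu hd; rewrite Umat_line => sdQ l.
apply: le_trans (perturbed_eigenvalue sd sdQ lr0 l) _; rewrite -/K.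
have K1 : 0 < K + 1 by rewrite ltr_wpDl.
move: hd; rewrite ltr_pdivlMr // => hd.
have : 0 <= `|h| by [].
by move: hd; rewrite mulrDr mulr1; lra.
Qed.

Lemma phi_specdec tau P lam g : specdec (Umat U tau) P lam -> phi U g tau =
  complex.Re ((adj (tocol g.1) *m (fcalc (@zcotz R) P lam *m tocol g.1)) 0 0) + 4 * dotr tau g.2.
Proof.
move=> sd; rewrite (frame_phi (specdec_frame sd)); congr (_ + _).
rewrite fcalc_form (_ : complex.Re _ = complex.Re (toC
  (\sum_k zcotz (lam k) * (dotr (rerow P k) g.1 ^+ 2 + dotr (imrow P k) g.1 ^+ 2)))) //.
congr complex.Re; rewrite /toC rmorph_sum; apply: eq_bigr => k _.
by rewrite -cnorm2E mul_tocol rmorphM.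
Qed.

Lemma nrm_sum n p (I : finType) (A : I -> 'M[C]_(n, p)) : nrm (\sum_i A i) <= \sum_i nrm (A i).
Proof.
rewrite /nrm [leRHS]exchange_big /=; apply: ler_sum => a _.
rewrite [leRHS]exchange_big /=; apply: ler_sum => b _.
by rewrite summxE; exact: nc_sum.
Qed.

(** [l] is chosen before t: endpoints over the same x share it, which makes their gradients
    comparable. The quotient is exactly [l' + 4 * t 0 j] by [fcalcB_divdiff], and [l'] tends to [l]
    by [fcalc_close] applied to the divided differences. *)
Lemma is_derive_phi theta j (x : 'rV[R]_q) P lam : specdec (Umat U theta) P lam ->
  (forall k, `|lam k| < pi) ->
  exists l : R, forall t, is_derive theta (ej R j) (phi U (x, t)) (l + 4 * t 0 j).
Proof.
move=> sd lpi; have [r [d0 [r0 rpi d00 lr near_r]]] := specdec_near j sd lpi.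
set D := Umat U (ej R j).
pose F k := divdiff (@zcotz R) (lam k).
pose A k := adj P *m delta_mx k k *m P *m D.
pose xc := tocol x.
pose l := complex.Re ((adj xc *m ((\sum_k A k *m fcalc (F k) P lam) *m xc)) 0 0).
have lE := erefl : l = complex.Re ((adj xc *m ((\sum_k A k *m fcalc (F k) P lam) *m xc)) 0 0).
clearbody l.
exists l => t.
have aux (v w a b c : R) : v + 4 * (a + b * c) - (w + 4 * a) = v - w + b * (4 * c) by ring.
suff cvgl : h^-1 *: ((phi U (x, t) \o shift theta) (h *: ej R j) - phi U (x, t) theta) @[h --> 0^']
    --> l + 4 * t 0 j.
  by apply: DeriveDef; [apply/cvg_ex; exists (l + 4 * t 0 j) | exact: cvg_lim cvgl].
apply/cvgrPdist_le => eps eps0.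
pose N : R := q%:R * q%:R.
pose B := nrm (adj xc) * (\sum_k nrm (A k)) * nrm xc * (N * N * N).
have N0 : 0 <= N by rewrite mulr_ge0.
have A0 : 0 <= \sum_k nrm (A k).
  by apply: sumr_ge0 => k _; exact: nrm_ge0.
have B0 : 0 <= B by rewrite !mulr_ge0 ?nrm_ge0.
pose e := eps / (B + 1); have e0 : 0 < e by rewrite divr_gt0 // ltr_wpDl.
have dz z : `|z| <= r -> derivable (@zcotz R) z 1.
  by move=> zr; apply: derivable_zcotz; exact: le_lt_trans rpi.
have /fin_all_exists[M HM] : forall k, exists M : R, 0 <= M /\
    forall z : R, `|z| <= r -> `|F k z| <= M.
  by move=> k; apply: divdiff_bounded.
have [d dgt0 Hd] : exists2 d : R, 0 < d & forall kk : 'I_q * 'I_q, forall z,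
    `|z - lam kk.2| < d -> `|F kk.1 z - F kk.1 (lam kk.2)| <= e.
  apply: (@fin_delta _ (fun kk d => forall z, `|z - lam kk.2| < d ->
    `|F kk.1 z - F kk.1 (lam kk.2)| <= e)) => [[k k']|kk d d' dd' H z zd]; last first.
    by apply: H; exact: lt_le_trans dd'.
  have := divdiff_continuous (dz _ (lr k)) (dz _ (lr k')).
  move=> /cvgrPdist_le/(_ e e0)/nbhs_ballP[d /= dgt0 dP]; exists d => // z zd.
  by rewrite distrC; apply: dP; rewrite /ball /= distrC.
pose Ms := \sum_k M k.
have MMs k : M k <= Ms.
  by rewrite /Ms (bigD1 k) //= lerDl; apply: sumr_ge0 => i _; case: (HM i).
have Ms0 : 0 <= Ms by apply: sumr_ge0 => i _; case: (HM i).
pose K := N * nrm D * N; have K0 : 0 <= K by rewrite !mulr_ge0 ?nrm_ge0.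
(* Gives the smallness condition of [fcalc_close] for all k at once, [Ms] dominating every [M k];
   the added 1 keeps the denominator positive. *)
pose d1 := e * d / (2 * Ms * K + 1).
have den0 : 0 < 2 * Ms * K + 1.
  by apply: ltr_wpDl; rewrite ?ltr01 // mulr_ge0 // mulr_ge0.
have d10 : 0 < d1 by rewrite divr_gt0 // mulr_gt0.
near=> h.
have h0 : h != 0 by near: h; exact: nbhs_dnbhs_neq.
have hd0 : `|h| < d0 by near: h; apply: dnbhs0_lt.
have hd1 : `|h| < d1 by near: h; apply: dnbhs0_lt.
have [Q [mu sdQ]] := hermitian_specdec (Umat_adj hskew (h *: ej R j + theta)).
have mr := near_r h Q mu hd0 sdQ.
have sdQ' := sdQ; rewrite Umat_line -/D in sdQ'.
have close k : nrm (fcalc (F k) Q mu - fcalc (F k) P lam) <= N * (N * e) * N.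
  have [M0 MF] := HM k.
  apply: (fcalc_close sd sdQ' dgt0 M0 lr mr MF) => [k' z|]; first exact: (Hd (k, k')).
  rewrite -/N -/K; move: hd1; rewrite /d1 ltr_pdivlMr // => /ltW; apply: le_trans.
  rewrite (_ : `|h| * (2 * Ms * K + 1) = 2 * Ms * (`|h| * K) + `|h|); last by ring.
  apply: (@le_trans _ _ (2 * Ms * (`|h| * K))); last by rewrite lerDl.
  by apply: ler_wpM2r; [rewrite mulr_ge0 | rewrite ler_pM2l].
rewrite /= (phi_specdec _ sd) (phi_specdec _ sdQ) /= -/xc.
pose l' := complex.Re ((adj xc *m ((\sum_k A k *m fcalc (F k) Q mu) *m xc)) 0 0).
have l'E := erefl : l' = complex.Re ((adj xc *m ((\sum_k A k *m fcalc (F k) Q mu) *m xc)) 0 0).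
clearbody l'.
have E1 : complex.Re ((adj xc *m (fcalc (@zcotz R) Q mu *m xc)) 0 0)
    - complex.Re ((adj xc *m (fcalc (@zcotz R) P lam *m xc)) 0 0)
    = h * l'.
  rewrite l'E.
  have ReB (z w : C) : complex.Re z - complex.Re w = complex.Re (z - w) by case: z; case: w.
  have ReZ (z : C) : h * complex.Re z = complex.Re (toC h * z).
    by case: z => a b /=; rewrite mul0r subr0.
  have mB (Y Z : 'M[C]_1) : Y 0 0 - Z 0 0 = (Y - Z) 0 0 by rewrite !mxE.
  have mZ c (Y : 'M[C]_1) : c * Y 0 0 = (c *: Y) 0 0 by rewrite !mxE.
  rewrite ReB ReZ mB mZ -mulmxBr -mulmxBl (fcalcB_divdiff sd sdQ').
  by rewrite -scalemxAl -scalemxAr.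
have E2 : dotr (h *: ej R j + theta) t = dotr theta t + h * t 0 j.
  rewrite /dotr (eq_bigr (fun a => theta 0 a * t 0 a + h * (ej R j 0 a * t 0 a))); last first.
    by move=> a _; rewrite !mxE; ring.
  rewrite big_split /= -mulr_sumr; congr (_ + _ * _).
  rewrite (bigD1 j) //= big1 => [|i ij]; first by rewrite mxE !eqxx mul1r addr0.
  by rewrite mxE (negbTE ij) andbF mul0r.
rewrite E2 /GRing.scale /= (_ : h^-1 * _ = l' + 4 * t 0 j); last first.
  rewrite (_ : _ - _ = h * (l' + 4 * t 0 j)); first by rewrite mulKf.
  by rewrite [h * (l' + _)]mulrDr -E1; exact: aux.
rewrite opprD addrACA subrr addr0 distrC.
have -> : l' - l = complex.Re ((adj xc *m ((\sum_k A k *m (fcalc (F k) Q mu - fcalc (F k) P lam)) *m xc)) 0 0).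
  have ReB (z w : C) : complex.Re z - complex.Re w = complex.Re (z - w) by case: z; case: w.
  have mB (Y Z : 'M[C]_1) : Y 0 0 - Z 0 0 = (Y - Z) 0 0 by rewrite !mxE.
  rewrite l'E lE ReB mB -mulmxBr -mulmxBl -sumrB.
  congr (complex.Re ((_ *m (_ *m _)) 0 0)).
  by apply: eq_bigr => k _; rewrite mulmxBr.
apply: le_trans (Re_nc _) _; apply: le_trans (nc_le_nrm _ _ _) _.
apply: (@le_trans _ _ (B * e)); last first.
  by rewrite /e mulrCA ger_pMr // ler_pdivrMr ?ltr_wpDl // mul1r lerDl.
apply: le_trans (nrmM _ _) _.
rewrite (_ : B * e = nrm (adj xc) * ((\sum_k nrm (A k) * (N * (N * e) * N)) * nrm xc)); last first.
  by rewrite -mulr_suml /B; ring.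
rewrite ler_wpM2l ?nrm_ge0 //; apply: le_trans (nrmM _ _) _.
rewrite ler_wpM2r ?nrm_ge0 //; apply: le_trans (nrm_sum _) _.
apply: ler_sum => k _; apply: le_trans (nrmM _ _) _.
by rewrite ler_wpM2l ?nrm_ge0.
Unshelve. all: by end_near. Qed.

End DerivablePhi.

(** * The distance at a critical point *)

Section Distance.
Variables (R : realType) (q m : nat) (U : 'I_m -> 'M[R]_q).
Hypothesis hskew : skew_family U.

Lemma curve_length_ge (tau : 'rV[R]_m) x t g (c : R) : Omega U tau -> 0 <= c ->
  phi U g tau = c ^+ 2 -> horizontal_curve U x t g -> (c%:E <= curve_length x)%E.
Proof.
move=> Ot c0 phic hc; have [lam [al [be [fr lpi]]]] := Umat_frame hskew tau.
have L0 : (0 <= curve_length x)%E by apply: integral_ge0 => s _; rewrite lee_fin sqrtr_ge0.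
case E : (curve_length x) L0 => [L||] // L0; last by rewrite leey.
have := phi_le_length2 fr (lpi Ot) hc E.
by rewrite phic lee_fin ler_pXn2r // nnegrE -lee_fin.
Qed.

Lemma is_derive_local_max (f : 'rV[R]_m -> R) theta v (l d : R) : 0 < d ->
  is_derive theta v f l ->
  (forall h : R, `|h| < d -> f (h *: v + theta) <= f theta) -> l = 0.
Proof.
move=> d0 [df dfl] fmax.
have : h^-1 *: ((f \o shift theta) (h *: v) - f theta) @[h --> 0^'] --> l by rewrite -dfl.
move=> /cvgrPdist_lt H; apply/eqP; apply: contraT => l0.
have l0' : 0 < `|l| by rewrite normr_gt0.
have := H _ l0'; rewrite near_withinE => /nbhs_ballP[e /= e0 eP].
pose s : R := Num.min d e / 2.
have s0 : 0 < s by rewrite divr_gt0 // lt_min d0.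
have sd : s < d by rewrite ltr_pdivrMr // (le_lt_trans (_ : _ <= d)) ?ge_min ?lexx //; lra.
have se : s < e by rewrite ltr_pdivrMr // (le_lt_trans (_ : _ <= e)) ?ge_min ?lexx ?orbT //; lra.
have dist0 (h : R) : `|h| = s -> `|l - h^-1 * (f (h *: v + theta) - f theta)| < `|l|.
  move=> hs; have := eP h; rewrite /ball /= sub0r normrN hs => /(_ se).
  by apply; rewrite -normr_gt0 hs.
have fs (h : R) : `|h| = s -> f (h *: v + theta) - f theta <= 0.
  by move=> hs; rewrite subr_le0; apply: fmax; rewrite hs.
have [lneg|lpos|l00] := ltgtP l 0; last by rewrite l00 eqxx in l0.
  have Es : `|- s| = s by rewrite normrN gtr0_norm.
  have := dist0 _ Es; have : 0 <= (- s)^-1 * (f (- s *: v + theta) - f theta).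
    by rewrite mulr_le0 ?fs // invr_le0 oppr_le0 ltW.
  rewrite (ltr0_norm lneg); move: (_ * _) => z z0.
  by rewrite ltr_norml => /andP[]; lra.
have Es : `|s| = s by rewrite gtr0_norm.
have := dist0 _ Es; have : s^-1 * (f (s *: v + theta) - f theta) <= 0.
  by rewrite mulr_ge0_le0 ?fs // invr_ge0 ltW.
rewrite (gtr0_norm lpos); move: (_ * _) => z z0.
by rewrite ltr_norml => /andP[]; lra.
Qed.

(* At a critical point the extremal with parameter [theta] ends exactly at [g]:
   [phi (x0, T) <= c ^ 2] near [theta] with equality at [theta], so [theta] is
   critical for [(x0, T)] too, and the gradients differ by [4 (t0 - T)]. *)
Lemma critical_extremal g (theta : 'rV[R]_m) : Omega U theta ->
  (forall j, partial j (phi U g) theta = 0) ->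
  exists x t, exists2 c : R, 0 <= c & [/\ horizontal_curve U x t g,
    curve_length x = c%:E & c ^+ 2 = phi U g theta].
Proof.
move=> Ot grad0; have [P [lam sd]] := hermitian_specdec (Umat_adj hskew theta).
have lpi k : `|lam k| < pi by apply: le_lt_trans Ot; exact: (opnorm_eigen sd).
have [x [t [T [c c0 [hc Lc cphi]]]]] := extremal g.1 (specdec_frame sd) lpi.
suff TE : T = g.2 by exists x, t; exists c => //; move: hc cphi; rewrite TE -surjective_pairing.
apply/rowP => j.
have [l dl] := is_derive_phi hskew j g.1 sd lpi.
have [r [d [r0 rpi d0 lr near_r]]] := specdec_near j sd lpi.
have lT : l + 4 * T 0 j = 0.
  apply: (is_derive_local_max d0 (dl T)) => h hd; rewrite -cphi.
  have [Q [mu sdQ]] := hermitian_specdec (Umat_adj hskew (h *: ej R j + theta)).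
  apply: (phi_le_length2 (specdec_frame sdQ) _ hc Lc) => k.
  by apply: le_lt_trans rpi; exact: near_r hd sdQ k.
have lg : l + 4 * g.2 0 j = 0.
  have := grad0 j; rewrite /partial; have [_ <-] := dl g.2.
  by rewrite -surjective_pairing.
lra.
Qed.

End Distance.

Theorem theorem2p3 (R : realType) (q m : nat) (U : 'I_m -> 'M[R]_q)
  (hq : (0 < q)%N) (hm : (0 < m)%N)
  (hskew : skew_family U) (hind : lin_indep U)
  (g0 : grp R q m) (theta0 : 'rV[R]_m)
  (hg0 : Mset U g0) (htheta0 : nondeg_crit U g0 theta0) :
  (dcc U g0 * dcc U g0 = (phi U g0 theta0)%:E)%E /\
  ereal_sup [set (phi U g0 tau)%:E | tau in Omega U] = (phi U g0 theta0)%:E.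
Proof.
have [Ot grad0 _] := htheta0.
have [x [t [c c0 [hc Lc cphi]]]] := critical_extremal hskew Ot grad0.
have dE : dcc U g0 = c%:E.
  apply/le_anti/andP; split; first by rewrite -Lc; apply: ereal_inf_lbound; exists x, t.
  (* Every competitor is at least as long as the extremal, by the lower bound at [theta0] itself. *)
  apply: le_ereal_inf_tmp => _ [y [s [hys ->]]].
  exact: (curve_length_ge hskew Ot c0 (esym cphi) hys).
split; first by rewrite dE -EFinM -expr2 cphi.
apply/le_anti/andP; split; last by apply: ereal_sup_ubound; exists theta0.
(* The extremal of [theta0] serves for every tau: its squared length bounds phi(g0; tau) and equals
   phi(g0; theta0). *)
apply: ge_ereal_sup => _ [tau Otau <-]; rewrite lee_fin -cphi.
have [lam [al [be [fr lpi]]]] := Umat_frame hskew tau.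
exact: (phi_le_length2 fr (lpi Otau) hc Lc).
Qed.
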